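(* Let $\mathcal G$ be a strongly connected digraph on $n$ nodes. Let $T_2\ge T_1>0$, $\mu>0$, $h\in\mathbb R$, $\gamma>0$, and let $P_1\in\mathbb R^{2(n-1)\times 2(n-1)}$, $P_2\in\mathbb R^{2\times2}$, $P_3\in\mathbb R^{2(n-1)\times 2(n-1)}$ be symmetric positive definite matrices such that $$A_{g_2}^\top \exp(A_{f_2}^\top\nu)P_1\exp(A_{f_2}\nu)A_{g_2}-P_1\prec0\quad\forall \nu\in[T_1,T_2],\qquad \Big|\exp\Big(\frac{\bar\kappa_1}{\alpha_2}T_2\Big)\Big(1-\frac{\bar\kappa_2}{\alpha_2}\Big)\Big|<1$$ (with the constants given in the context). Then the hybrid system $\widetilde{\mathcal H}_{m_\sigma}$ with input $\bar m_\sigma$ is input-to-state stable with respect to $$\widetilde{\mathcal A}_\varepsilon=\{\chi\in\mathcal X_\varepsilon:\bar z_1=(e^*,0),\bar z_2=0,\bar w_1=0,\bar w_2=0,\ e^*\in\mathbb R\}.$$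
   Context: Notation. $|\cdot|$ is the Euclidean norm of a vector and the spectral norm of a matrix; $|x|_\Sigma=\inf_{y\in\Sigma}|x-y|$; $\lambda_{\min},\lambda_{\max}$ are extreme eigenvalues of a symmetric matrix. Graph. $\mathcal G=(\mathcal V,\mathcal E,A)$ is a digraph with $\mathcal V=\{1,\dots,n\}$, $a_{ik}=1$ if $(i,k)\in\mathcal E$ and $0$ otherwise; $\mathcal D$ is the diagonal matrix of in-degrees $\sum_k a_{ki}$; $\mathcal L=\mathcal D-A^\top$ is the Laplacian, $(\mathcal Le)_i=\sum_{k:(k,i)\in\mathcal E}(e_i-e_k)$. Strongly connected: any two distinct nodes are joined by a directed path. $\mathcal T=[v_1,\mathcal T_1]$ is a nonsingular real matrix, $v_1=\frac1{\sqrt n}\mathbf 1_n$, columns of $\mathcal T_1$ the remaining eigenvectors of $\mathcal L$, with $\mathcal T^{-1}\mathcal L\mathcal T=\begin{bmatrix}0&0\\0&\bar{\mathcal L}\end{bmatrix}$, $\bar{\mathcal L}=\mathrm{diag}(\lambda_2,\dots,\lambda_n)$ containing the remaining (nonnegative) eigenvalues. Matrices, with $I=I_{n-1}$: $A_{f_1}=\begin{bmatrix}0&1\\0&h\end{bmatrix}$, $A_{f_2}=\begin{bmatrix}0&I\\0&hI\end{bmatrix}$, $A_{f_3}=\begin{bmatrix}0&\mu\\-1&-1\end{bmatrix}$, $A_{f_4}=\begin{bmatrix}0&\mu I\\-I&-I\end{bmatrix}$, $B_{f_1}=\begin{bmatrix}1&0\\0&0\end{bmatrix}$, $B_{f_2}=\begin{bmatrix}I&0\\0&0\end{bmatrix}$,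 $A_{g_1}=\begin{bmatrix}1&0\\0&0\end{bmatrix}$, $A_{g_2}=\begin{bmatrix}I&0\\-\gamma\bar{\mathcal L}&0\end{bmatrix}$. Constants. $\epsilon>0$; $\beta_1,\beta_2>0$ satisfy $P_2A_{f_3}+A_{f_3}^\top P_2\preceq-\beta_1I_2$ and $P_3A_{f_4}+A_{f_4}^\top P_3\preceq-\beta_2I_{2(n-1)}$ (these inequalities are thus part of the hypotheses); $\kappa_1=2\max_{\nu\in[0,T_2]}|\exp(A_{f_2}^\top\nu)P_1\exp(A_{f_2}\nu)|$; $\bar\kappa_1=\max\{\frac{\kappa_1}{2\epsilon},\frac{\kappa_1\epsilon}2-\beta_2\}$; $\kappa_2\in(0,-\min_{\nu\in[T_1,T_2]}\lambda_{\min}(A_{g_2}^\top\exp(A_{f_2}^\top\nu)P_1\exp(A_{f_2}\nu)A_{g_2}-P_1))$; $\bar\kappa_2=\min\{1,\kappa_2\}$; $\alpha_2=\max_{\nu\in[0,T_2]}\{\exp(2h\nu),\lambda_{\max}(\exp(A_{f_2}^\top\nu)P_1\exp(A_{f_2}\nu)),\lambda_{\max}(P_2),\lambda_{\max}(P_3)\}$. System $\widetilde{\mathcal H}_{m_\sigma}$. State $\chi=(\bar z_1,\bar z_2,\bar w_1,\bar w_2,\tau)\in\mathcal X_\varepsilon:=\mathbb R^2\times\mathbb R^{2(n-1)}\times\mathbb R^2\times\mathbb R^{2(n-1)}\times[0,T_2]$, where $\bar z_1=(\bar e_1,\bar\eta_1)$, $\bar z_2=(\bar e_2,\dots,\bar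 e_n,\bar\eta_2,\dots,\bar\eta_n)$. Input: $\bar m_\sigma=(\bar m_{\sigma_1},\bar m_{\sigma_2})=\mathcal T^{-1}\varepsilon_\sigma$, $\bar m_{\sigma_1}\in\mathbb R$, $\bar m_{\sigma_2}\in\mathbb R^{n-1}$, where $\varepsilon_{\sigma}\in\mathbb R^n$, $\varepsilon_{\sigma_i}=\sigma_i-\sigma^*$, is the error on the clock rate reference. For $\chi\in\mathcal X_\varepsilon$: $\dot\chi=(A_{f_1}\bar z_1+B_{f_1}\bar w_1+(\bar m_{\sigma_1},0),\ A_{f_2}\bar z_2+B_{f_2}\bar w_2+(\bar m_{\sigma_2},0),\ A_{f_3}\bar w_1,\ A_{f_4}\bar w_2,\ -1)$ (i.e. the input enters the $\bar e$ equations). For $\chi\in\mathcal X_\varepsilon$ with $\tau=0$: $\chi^+\in(A_{g_1}\bar z_1,A_{g_2}\bar z_2,\bar w_1,\bar w_2,[T_1,T_2])$. Solutions and ISS. Solutions are defined on hybrid time domains $E\subset\mathbb R_{\ge0}\times\mathbb N$ (for each $(T,J)\in E$, $E\cap([0,T]\times\{0,\dots,J\})=\bigcup_{j=0}^J[t_j,t_{j+1}]\times\{j\}$ with $0=t_0\le\dots\le t_{J+1}$), are locally absolutely continuous in $t$ for each $j$, satisfy the differential equation in the flow set on flow intervals and the inclusion in the jump set at jumps; a solution pair $(\phi,m)$ consists of a state trajectory and an input on the same domain; $|m|_\infty$ is the sup norm of the input. The system is input-to-state stable with respect to a set $\mathcal A$ if there are $\beta\in\mathcal{KL}$, $\kappa\in\mathcal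 K$ such that every solution pair satisfies $|\phi(t,j)|_{\mathcal A}\le\max\{\beta(|\phi(0,0)|_{\mathcal A},t+j),\kappa(|m|_\infty)\}$ for all $(t,j)\in\mathrm{dom}\,\phi$. *)

(* Defs.v *)
From HB Require Import structures.
From mathcomp Require Import all_boot all_order all_algebra.
From mathcomp Require Import all_classical all_reals all_analysis.

Set Implicit Arguments.
Unset Strict Implicit.
Unset Printing Implicit Defensive.

Import Order.TTheory GRing.Theory Num.Theory.
Import numFieldNormedType.Exports.

Local Open Scope classical_set_scope.
Local Open Scope ring_scope.

(* The norm that MathComp-Analysis puts on matrices is the max norm, hence the
   Euclidean and spectral norms below.  The topology is the same. *)

Definition enorm (R : realType) (p : nat) (x : 'cV[R]_p) : R :=
  Num.sqrt (\sum_i x i 0 ^+ 2).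

Definition dist_to (R : realType) (p : nat) (S : set 'cV[R]_p) (x : 'cV[R]_p) : R :=
  inf [set enorm (x - y) | y in S].

Definition spectral_norm (R : realType) (p q : nat) (A : 'M[R]_(p, q)) : R :=
  sup [set enorm (A *m x) | x in [set x : 'cV[R]_q | enorm x <= 1]].

Definition lambda_max (R : realType) (p : nat) (A : 'M[R]_p) : R :=
  sup [set a | eigenvalue A a].

Definition lambda_min (R : realType) (p : nat) (A : 'M[R]_p) : R :=
  inf [set a | eigenvalue A a].

Definition qform (R : realType) (p : nat) (A : 'M[R]_p) (x : 'cV[R]_p) : R :=
  (x^T *m A *m x) 0 0.

Definition sym_posdef (R : realType) (p : nat) (A : 'M[R]_p) : Prop :=
  A^T = A /\ forall x : 'cV[R]_p, x != 0 -> 0 < qform A x.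

Definition negdef (R : realType) (p : nat) (A : 'M[R]_p) : Prop :=
  forall x : 'cV[R]_p, x != 0 -> qform A x < 0.

Definition loewner_le (R : realType) (p : nat) (A B : 'M[R]_p) : Prop :=
  forall x : 'cV[R]_p, qform A x <= qform B x.

Definition expm (R : realType) (p : nat) (A : 'M[R]_p) : 'M[R]_p :=
  limn (series (fun k : nat => (k`!%:R : R)^-1 *: (A ^+ k : 'M[R]_p))).

(* * Comparison functions, seen on [0, +oo[ only *)

Definition classK (R : realType) (k : R -> R) : Prop :=
  [/\ k 0 = 0,
      {within [set s | 0 <= s], continuous k} &
      forall s t, 0 <= s -> s < t -> k s < k t].

Definition classKL (R : realType) (b : R -> R -> R) : Prop :=
  [/\ {within [set p : R * R | 0 <= p.1 /\ 0 <= p.2],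
         continuous (fun p : R * R => b p.1 p.2)},
      forall t, 0 <= t -> classK (b^~ t),
      forall s t u, 0 <= s -> 0 <= t -> t <= u -> b s u <= b s t &
      forall s, 0 <= s -> b s t @[t --> +oo] --> (0 : R)].

(* * Hybrid systems with inputs *)

Definition hybrid_time_domain (R : realType) (E : set (R * nat)) : Prop :=
  (forall p, E p -> 0 <= p.1) /\
  forall (T : R) (J : nat), E (T, J) ->
    exists t : nat -> R,
      [/\ t 0%N = 0,
          forall j, (j <= J)%N -> t j <= t j.+1 &
          E `&` [set p | 0 <= p.1 <= T /\ (p.2 <= J)%N] =
          [set p | (p.2 <= J)%N /\ t p.2 <= p.1 <= t p.2.+1]].

Definition flow_interval (R : realType) (E : set (R * nat)) (j : nat) : set R :=
  [set t | E (t, j)].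

Definition abs_continuous (R : realType) (p : nat) (a b : R) (f : R -> 'cV[R]_p) : Prop :=
  forall eps : R, 0 < eps -> exists2 delta : R, 0 < delta &
    forall (N : nat) (s t : 'I_N -> R),
      (forall i, a <= s i /\ s i <= t i /\ t i <= b) ->
      trivIset setT (fun i => `]s i, t i[%classic) ->
      \sum_i (t i - s i) < delta ->
      \sum_i enorm (f (t i) - f (s i)) < eps.

Definition locally_abs_continuous (R : realType) (p : nat) (I : set R)
    (f : R -> 'cV[R]_p) : Prop :=
  forall a b, a <= b -> `[a, b]%classic `<=` I -> abs_continuous a b f.

Record hybrid_system (R : realType) (p q : nat) := HybridSystem {
  flow_set : set 'cV[R]_p;
  flow_map : 'cV[R]_p -> 'cV[R]_q -> 'cV[R]_p;
  jump_set : set 'cV[R]_p;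
  jump_map : 'cV[R]_p -> set 'cV[R]_p;
  input_set : set 'cV[R]_q }.

(* [phi t j] and [m t j] are only meaningful for [(t, j)] in [E]. *)
Definition solution_pair (R : realType) (p q : nat) (H : hybrid_system R p q)
    (E : set (R * nat)) (phi : R -> nat -> 'cV[R]_p) (m : R -> nat -> 'cV[R]_q) : Prop :=
  [/\ hybrid_time_domain E,
      forall t j, E (t, j) -> input_set H (m t j),
      (closure (flow_set H) `|` jump_set H) (phi 0 0%N),
      forall j, let I := flow_interval E j in
        [/\ locally_abs_continuous I (phi^~ j),
            forall t, I° t -> flow_set H (phi t j) &
            {ae lebesgue_measure, forall t : R, I° t ->
               is_derive t (1 : R) (phi^~ j) (flow_map H (phi t j) (m t j))}] &
      forall t j, E (t, j) -> E (t, j.+1) ->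
        jump_set H (phi t j) /\ jump_map H (phi t j) (phi t j.+1)].

Definition input_norms (R : realType) (q : nat) (E : set (R * nat))
    (m : R -> nat -> 'cV[R]_q) : set R :=
  [set enorm (m p.1 p.2) | p in E].

(* The bound involves the real number [kappa |m|_oo], so it is stated for bounded
   inputs ([sup] of an unbounded set is 0). *)
Definition input_to_state_stable (R : realType) (p q : nat) (H : hybrid_system R p q)
    (A : set 'cV[R]_p) : Prop :=
  exists (beta : R -> R -> R) (kappa : R -> R),
    [/\ classKL beta, classK kappa &
      forall E phi m, solution_pair H E phi m -> has_ubound (input_norms E m) ->
        forall t j, E (t, j) ->
          dist_to A (phi t j) <=
          Num.max (beta (dist_to A (phi 0 0%N)) (t + j%:R))
                  (kappa (sup (input_norms E m)))].

(* * Digraphs.  There are 1 + n nodes, so that n is the dimension n - 1 of the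
   usual notation. *)

Definition strongly_connected (n : nat) (e : rel 'I_n) : Prop :=
  forall i j, i != j -> connect e i j.

Definition adjacency (R : realType) (n : nat) (e : rel 'I_n) : 'M[R]_n :=
  \matrix_(i, k) (e i k)%:R.

Definition laplacian (R : realType) (n : nat) (e : rel 'I_n) : 'M[R]_n :=
  diag_mx (\row_i \sum_k adjacency R e k i) - (adjacency R e)^T.

Definition laplacian_basis (R : realType) (n : nat) (e : rel 'I_(1 + n))
    (T : 'M[R]_(1 + n)) (lam : 'rV[R]_n) : Prop :=
  [/\ lsubmx T = const_mx (Num.sqrt (1 + n)%:R)^-1,
      T \in unitmx,
      invmx T *m laplacian R e *m T = block_mx 0 0 0 (diag_mx lam) &
      forall i, 0 <= lam 0 i].

(* * System matrices *)

Definition A_f1 (R : realType) (h : R) : 'M[R]_(1 + 1) := block_mx 0 1%:M 0 h%:M.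
Definition A_f2 (R : realType) (n : nat) (h : R) : 'M[R]_(n + n) :=
  block_mx 0 1%:M 0 h%:M.
Definition A_f3 (R : realType) (mu : R) : 'M[R]_(1 + 1) :=
  block_mx 0 mu%:M (- 1%:M) (- 1%:M).
Definition A_f4 (R : realType) (n : nat) (mu : R) : 'M[R]_(n + n) :=
  block_mx 0 mu%:M (- 1%:M) (- 1%:M).
Definition B_f1 (R : realType) : 'M[R]_(1 + 1) := block_mx 1%:M 0 0 0.
Definition B_f2 (R : realType) (n : nat) : 'M[R]_(n + n) := block_mx 1%:M 0 0 0.
Definition A_g1 (R : realType) : 'M[R]_(1 + 1) := block_mx 1%:M 0 0 0.
Definition A_g2 (R : realType) (n : nat) (gamma : R) (lam : 'rV[R]_n) : 'M[R]_(n + n) :=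
  block_mx 1%:M 0 (- (gamma *: diag_mx lam)) 0.

(* * Constants *)

Definition expP (R : realType) (n : nat) (h : R) (P1 : 'M[R]_(n + n)) (nu : R) :
    'M[R]_(n + n) :=
  expm (nu *: (A_f2 n h)^T) *m P1 *m expm (nu *: A_f2 n h).

Definition jump_decrease (R : realType) (n : nat) (h gamma : R) (lam : 'rV[R]_n)
    (P1 : 'M[R]_(n + n)) (nu : R) : 'M[R]_(n + n) :=
  (A_g2 gamma lam)^T *m expP h P1 nu *m A_g2 gamma lam - P1.

Definition kappa1 (R : realType) (n : nat) (h T2 : R) (P1 : 'M[R]_(n + n)) : R :=
  2 * sup [set spectral_norm (expP h P1 nu) | nu in `[0, T2]].

Definition kappa1_bar (R : realType) (n : nat) (h T2 eps beta2 : R)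
    (P1 : 'M[R]_(n + n)) : R :=
  Num.max (kappa1 h T2 P1 / (2 * eps)) (kappa1 h T2 P1 * eps / 2 - beta2).

Definition kappa2_sup (R : realType) (n : nat) (h gamma T1 T2 : R) (lam : 'rV[R]_n)
    (P1 : 'M[R]_(n + n)) : R :=
  - inf [set lambda_min (jump_decrease h gamma lam P1 nu) | nu in `[T1, T2]].

Definition kappa2_bar (R : realType) (kappa2 : R) : R := Num.min 1 kappa2.

Definition alpha2 (R : realType) (n : nat) (h T2 : R) (P1 : 'M[R]_(n + n))
    (P2 : 'M[R]_(1 + 1)) (P3 : 'M[R]_(n + n)) : R :=
  sup [set Num.max (expR (2 * h * nu))
             (Num.max (lambda_max (expP h P1 nu))
                (Num.max (lambda_max P2) (lambda_max P3))) | nu in `[0, T2]].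

(* * The hybrid system; a state is the column (z1, z2, w1, w2, tau) *)

Definition state_dim (n : nat) : nat :=
  ((1 + 1) + ((n + n) + ((1 + 1) + ((n + n) + 1))))%N.

Definition mk_state (R : realType) (n : nat) (z1 : 'cV[R]_(1 + 1)) (z2 : 'cV[R]_(n + n))
    (w1 : 'cV[R]_(1 + 1)) (w2 : 'cV[R]_(n + n)) (tau : R) : 'cV[R]_(state_dim n) :=
  col_mx z1 (col_mx z2 (col_mx w1 (col_mx w2 (tau%:M : 'cV[R]_1)))).

Definition st_z1 (R : realType) (n : nat) (chi : 'cV[R]_(state_dim n)) :
  'cV[R]_(1 + 1) := usubmx chi.
Definition st_z2 (R : realType) (n : nat) (chi : 'cV[R]_(state_dim n)) :
  'cV[R]_(n + n) := usubmx (dsubmx chi).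
Definition st_w1 (R : realType) (n : nat) (chi : 'cV[R]_(state_dim n)) :
  'cV[R]_(1 + 1) := usubmx (dsubmx (dsubmx chi)).
Definition st_w2 (R : realType) (n : nat) (chi : 'cV[R]_(state_dim n)) :
  'cV[R]_(n + n) := usubmx (dsubmx (dsubmx (dsubmx chi))).
Definition st_tau (R : realType) (n : nat) (chi : 'cV[R]_(state_dim n)) : R :=
  (dsubmx (dsubmx (dsubmx (dsubmx chi))) : 'cV[R]_1) 0 0.

Definition X_eps (R : realType) (n : nat) (T2 : R) : set 'cV[R]_(state_dim n) :=
  [set chi | 0 <= st_tau chi <= T2].

Definition A_eps (R : realType) (n : nat) (T2 : R) : set 'cV[R]_(state_dim n) :=
  [set chi | @X_eps R n T2 chi /\
     exists estar : R,
       [/\ st_z1 chi = col_mx (estar%:M : 'cV[R]_1) 0,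
           st_z2 chi = 0, st_w1 chi = 0 & st_w2 chi = 0]].

(* The coordinates T^-1 eps_sigma of the clock rate errors
   eps_sigma,i = sigma_i - sigma_star; since T is nonsingular and sigma is
   arbitrary, every vector is an admissible input value. *)
Definition clock_rate_inputs (R : realType) (n : nat) (T : 'M[R]_(1 + n))
    (sigma_star : R) : set 'cV[R]_(1 + n) :=
  [set invmx T *m (sigma - const_mx sigma_star) | sigma in [set: 'cV[R]_(1 + n)]].

Definition H_msigma (R : realType) (n : nat) (T1 T2 mu h gamma : R) (T : 'M[R]_(1 + n))
    (lam : 'rV[R]_n) (sigma_star : R) : hybrid_system R (state_dim n) (1 + n) := {|
  flow_set := @X_eps R n T2;
  flow_map := fun chi m =>
    mk_state
      (A_f1 h *m st_z1 chi + B_f1 R *m st_w1 chi + col_mx (usubmx m) 0)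
      (A_f2 n h *m st_z2 chi + B_f2 R n *m st_w2 chi + col_mx (dsubmx m) 0)
      (A_f3 mu *m st_w1 chi)
      (A_f4 n mu *m st_w2 chi)
      (- 1);
  jump_set := [set chi | @X_eps R n T2 chi /\ st_tau chi = 0];
  jump_map := fun chi =>
    [set mk_state (A_g1 R *m st_z1 chi) (A_g2 gamma lam *m st_z2 chi)
           (st_w1 chi) (st_w2 chi) nu | nu in `[T1, T2]];
  input_set := clock_rate_inputs T sigma_star |}.

(* Main.v *)
(** The coupling between the parts of the system is triangular.  The controller states [w1],
    [w2] evolve autonomously and are continuous at jumps, so the Lyapunov functions [P2], [P3]
    make them decay like [exp (- k t)].  The rate error [eta1] is reset to 0 at the first jump.
    For [z2 = (e, eta)], the state [x = expm (tau A_f2) z2] predicted at the next jump obeys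
    [x' = (w + m, 0)], because [A_f2 (u, 0) = 0], and [x+ = expm (nu A_f2) A_g2 x] at a jump.
    Since [A_f2 ^ 2 = h A_f2], the matrix [expm (nu A_f2)] is affine in a monotone function of
    [nu], hence by convexity of the norm [sqrt (x^T P1 x)] the jumps contract it by a factor
    uniform in [nu].  Consecutive jumps are between [T1] and [T2] apart, except for the first
    one, and everything reduces to a scalar recursion
    [Y_(j+1) <= rho (Y_j + C (q ^ j W + M))] with [rho, q < 1]. *)

Require Import Defs.
From HB Require Import structures.
From mathcomp Require Import all_boot all_order all_algebra.
From mathcomp Require Import all_classical all_reals all_analysis.
From mathcomp Require Import ring lra.

Set Implicit Arguments.
Unset Strict Implicit.
Unset Printing Implicit Defensive.

Import Order.TTheory GRing.Theory Num.Theory.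
Import numFieldNormedType.Exports.

Local Open Scope classical_set_scope.
Local Open Scope ring_scope.

(** * Monotonicity of absolutely continuous functions *)

(** Solutions are only absolutely continuous and obey the differential equation almost everywhere,
    so no flow is integrated explicitly. Each flow estimate chooses a scalar function whose
    derivative is almost everywhere zero, nonpositive or bounded (an invariant, a quantity times an
    integrating factor, a coordinate of the predicted state) and applies [ae_derive_le_growth],
    which rests on a direct covering argument. Between jumps [z2] itself may grow, while its
    prediction only accumulates the disturbance; hence strict decrease is asked of the jumps alone.
    Taking the norm instead of the quadratic form keeps the recursion linear, and so the gain is
    linear in the input. When a jump ends the first interval, its length is the initial timer value,
    possibly 0. Elapsed time is thus bounded below only by [(j - 1) T1], and the shift costs a
    constant factor. Conversely [t <= (j + 1) T2] turns geometric decay in [j] into decay in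
    [t + j]. Most estimates use the max norm; the Euclidean distance and input size are compared
    with it at the end, up to a factor depending on the dimension. *)

Definition real_abs_continuous (R : realType) (a b : R) (f : R -> R) : Prop :=
  forall eps : R, 0 < eps -> exists2 delta : R, 0 < delta &
    forall (N : nat) (s t : 'I_N -> R),
      (forall i, a <= s i /\ s i <= t i /\ t i <= b) ->
      trivIset setT (fun i => `]s i, t i[%classic) ->
      \sum_i (t i - s i) < delta ->
      \sum_i `|f (t i) - f (s i)| < eps.

(* [reach x]: up to [x], the growth of [f] is paid for by the slope [eps] and by
   finitely many intervals inside [U]. *)
Definition reach (R : realType) (f : R -> R) (a eps : R) (U : set R) (x : R) : Prop :=
  exists (N : nat) (s t : 'I_N -> R),
    [/\ forall i, [/\ a <= s i, s i <= t i, t i <= x & `]s i, t i[%classic `<=` U],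
        trivIset setT (fun i => `]s i, t i[%classic) &
        f x - f a <= eps * (x - a) + \sum_i `|f (t i) - f (s i)|].

Lemma reach_slope (R : realType) (f : R -> R) (a eps : R) (U : set R) (x y : R) :
  x <= y -> f y - f x <= eps * (y - x) -> reach f a eps U x -> reach f a eps U y.
Proof.
move=> xy fxy [N [s [t [st tr fx]]]]; exists N, s, t; split => //.
  by move=> i; have [? ? ? ?] := st i; split => //; apply: le_trans xy.
lra.
Qed.

Lemma reach_jump (R : realType) (f : R -> R) (a eps : R) (U : set R) (x y : R) :
  0 <= eps -> a <= x -> x <= y -> `]x, y[%classic `<=` U ->
  reach f a eps U x -> reach f a eps U y.
Proof.
move=> eps0 ax xy xyU [N [s [t [st tr fx]]]].
(* [ext u z] appends [z] to the family [u]. The new interval []x, y[] misses the old ones because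
   they all end at or before [x]. *)
pose ext (u : 'I_N -> R) z (i : 'I_(N + 1)) :=
  match fintype.split i with inl j => u j | inr _ => z end.
have extl u z j : ext u z (lshift 1 j) = u j by rewrite /ext (unsplitK (inl _ j)).
have extr u z j : ext u z (rshift N j) = z by rewrite /ext (unsplitK (inr _ j)).
exists (N + 1)%N, (ext s x), (ext t y); split.
- move=> i; rewrite -(fintype.splitK i); case: (fintype.split i) => j /=; rewrite ?extl ?extr //.
  by have [? ? tx ?] := st j; split => //; apply: le_trans xy.
- move=> i j _ _; rewrite -(fintype.splitK i) -(fintype.splitK j).
  case: (fintype.split i) => k; case: (fintype.split j) => l /=;
    rewrite ?extl ?extr => -[z [/= zi zj]].
  + by rewrite (tr k l) //; exists z.
  + exfalso; have [_ _ tx _] := st k; move: zi zj; rewrite !in_itv /=.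
    by move=> /andP[_ z1] /andP[z2 _]; lra.
  + exfalso; have [_ _ tx _] := st l; move: zi zj; rewrite !in_itv /=.
    by move=> /andP[z2 _] /andP[_ z1]; lra.
  + by rewrite !ord1.
- rewrite big_split_ord /= big_ord1 !extr.
  under eq_bigr do rewrite !extl.
  have := ler_norm (f y - f x); have : 0 <= eps * (y - x) by rewrite mulr_ge0 // subr_ge0.
  lra.
Qed.

(** By disjointness the total length is the measure of the union, which lies in [U]. *)
Lemma sum_length_le (R : realType) (U : set R) (d : R) (N : nat) (s t : 'I_N -> R) :
  open U -> (lebesgue_measure U < d%:E)%E ->
  (forall i, s i <= t i /\ `]s i, t i[%classic `<=` U) ->
  trivIset setT (fun i => `]s i, t i[%classic) ->
  \sum_i (t i - s i) < d.
Proof.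
move=> oU Ud st tr.
rewrite -lte_fin; apply: le_lt_trans Ud.
pose F (i : 'I_N) : set (measurableTypeR R) := `]s i, t i[%classic.
have mF i : measurable (F i) by exact: measurable_itv.
have mbF : measurable (\big[setU/set0]_i F i) by apply: bigsetU_measurable => i _.
have -> : (\sum_i (t i - s i))%:E =
          (@lebesgue_measure R (\big[setU/set0]_i F i) : \bar R).
  rewrite (measure_semi_additive_ord lebesgue_measure mF tr mbF).
  rewrite -sumEFin; apply: eq_bigr => i _.
  apply/esym; apply: etrans (lebesgue_measure_itv `]s i, t i[%R) _ => /=; rewrite lte_fin.
  case: ltP => // h; have [sti _] := st i.
  by have /eqP -> : t i == s i; [rewrite eq_le h sti | rewrite subrr].
apply: le_measure; rewrite ?inE //; first exact: measurable_realfun.open_measurable.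
apply: (big_ind (fun A : set _ => A `<=` U)) => //.
- by move=> A B AU BU; rewrite subUset.
- by move=> i _; exact: (st i).2.
Qed.

Lemma is_derive_slope (R : realType) (f : R -> R) (z d eps : R) :
  0 < eps -> is_derive z (1 : R) f d ->
  exists2 r, 0 < r & forall x, `|x - z| < r -> `|f x - f z - d * (x - z)| <= eps * `|x - z|.
Proof.
move=> eps0 [df dE].
have : (fun h => h^-1 *: (f (h *: 1 + z) - f z)) @ 0^' --> d.
  by rewrite -dE; exact: df.
move/cvgrPdist_le => /(_ _ eps0) [r /= r0 rP].
exists r => // x xz; have [->|xNz] := eqVneq x z.
  by rewrite !subrr mulr0 subr0 normr0 mulr0.
have h0 : x - z != 0 by rewrite subr_eq0.
have := rP (x - z); rewrite /ball_ /= sub0r normrN => /(_ xz h0).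
rewrite scaler1 subrK => hle.
have -> : f x - f z - d * (x - z) = (x - z) * ((x - z)^-1 * (f x - f z) - d).
  by rewrite [RHS]mulrBr mulrA mulfV // mul1r [d * _]mulrC.
by rewrite normrM mulrC ler_wpM2r // distrC.
Qed.

(** The points without a good derivative are covered by an open [U] so small that absolute
    continuity bounds the increments inside it by [eps]; elsewhere the local slope is at most
    [c + eps]. Real induction from [a] to [b] glues the two kinds of pieces. *)
Lemma ae_derive_le_growth (R : realType) (f : R -> R) (a b c : R) :
  a <= b -> 0 <= c -> real_abs_continuous a b f ->
  {ae lebesgue_measure, forall t : R, a < t < b ->
     exists2 d, is_derive t (1 : R) f d & d <= c} ->
  f b - f a <= c * (b - a).
Proof.
move=> ab c0 acf [A [mA A0 AP]].
suff key eps : 0 < eps -> f b - f a <= (c + eps) * (b - a) + eps.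
  apply/ler_addgt0Pr => eps eps0.
  have k1 : 0 < 1 + (b - a) by lra.
  have := key (eps / (1 + (b - a))) (divr_gt0 eps0 k1).
  have : eps / (1 + (b - a)) * (1 + (b - a)) = eps by rewrite divfK // gt_eqF.
  by move: (eps / (1 + (b - a))) => e1; lra.
move=> eps0; have [delta delta0 acP] := acf _ eps0.
(* The derivative bound is known strictly inside []a, b[] only, so the endpoints join the
   exceptional set. *)
pose A' := A `|` ([set a] `|` [set b]).
have mA' : measurable A' by apply: measurableU => //; exact: measurableU.
have A'0 : lebesgue_measure A' = 0%:E.
  apply/eqP; rewrite -measure_le0.
  apply: le_trans (measureU2 _ mA _) _; first exact: measurableU.
  rewrite [X in (X + _)%E](_ : _ = 0%:E) ?add0e; last exact: A0.
  apply: le_trans (measureU2 _ _ _) _ => //.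
  rewrite [X in (X + _)%E](_ : _ = 0%:E); last exact: lebesgue_measure_set1.
  by rewrite add0e [leLHS](_ : _ = 0%:E) //; exact: lebesgue_measure_set1.
have [//|U [oU A'U Ud]] := @lebesgue_regularity_outer R A' delta mA' _ delta0.
  by rewrite [ltLHS](_ : _ = 0%:E) ?ltry.
(* Outer regularity bounds [U] minus [A']; since [A'] is null, [U] has the same bound. *)
have {}Ud : (lebesgue_measure U < delta%:E)%E.
  apply: le_lt_trans Ud.
  have mU : measurable U by exact: measurable_realfun.open_measurable.
  have -> : U = (U `\` A') `|` A'.
    rewrite eqEsubset; split=> x; last by move=> [[]//|/A'U].
    by move=> Ux; have [|] := pselect (A' x); [right | left].
  apply: le_trans (measureU2 _ _ _) _ => //; first exact: measurableD.
  rewrite [X in (_ + X)%E](_ : _ = 0%:E) // adde0; apply: le_measure; rewrite ?inE //.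
  - exact: measurableD.
  - by apply: measurableD => //; apply: measurableU => //; exact: measurableD.
  - by move=> x [Ux nx]; split => //; left.
have ce0 : 0 <= c + eps by lra.
(* Reachability passes across [z]. If [z] is in [U], the interval []x, y[] is spent. Otherwise [f]
   is derivable at [z], and as [x <= z <= y] the errors [eps * (z - x)] and [eps * (y - z)] add up
   to exactly [eps * (y - x)]. *)
have loc z : a <= z <= b -> exists2 r, 0 < r & forall x y,
    a <= x -> x <= z -> z <= y -> z - r < x -> y < z + r ->
    reach f a (c + eps) U x -> reach f a (c + eps) U y.
  move=> /andP[az zb]; have [Uz|nUz] := pselect (U z).
    have [r /= r0 rU] := (open_nbhs_nbhs (conj oU Uz)).
    exists r => // x y ax xz zy zrx yzr; apply: reach_jump => //; first exact: le_trans zy.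
    move=> w /=; rewrite in_itv /= => /andP[xw wy]; apply: rU.
    by rewrite /ball_ /= ltr_norml; lra.
  have nz : ~ A' z by move=> /A'U.
  have : [set t | a < t < b -> exists2 d, is_derive t (1 : R) f d & d <= c] z.
    by apply: contrapT => /AP Az; apply: nz; left.
  have zab : a < z < b.
    rewrite !lt_neqAle az zb !andbT; apply/andP; split; apply/eqP => e; apply: nz; right.
      by left.
    by right.
  move=> /= /(_ zab)[d df dc].
  have [r r0 rP] := is_derive_slope eps0 df.
  exists r => // x y ax xz zy zrx yzr; apply: reach_slope; first exact: le_trans zy.
  have xr : `|x - z| < r by rewrite ltr_norml; lra.
  have yr : `|y - z| < r by rewrite ltr_norml; lra.
  move: (rP _ xr) (rP _ yr).
  rewrite (ger0_norm (_ : 0 <= y - z)) ?subr_ge0 // (ler0_norm (_ : x - z <= 0)) ?subr_le0 //.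
  rewrite !ler_norml => /andP[h1 h2] /andP[h3 h4].
  have : d * (y - x) <= c * (y - x) by rewrite ler_wpM2r //; lra.
  lra.
pose S := [set x | a <= x <= b /\ reach f a (c + eps) U x].
have Sa : S a.
  split; first by rewrite lexx ab.
  exists 0%N, (fun=> a), (fun=> a); split.
  - by case.
  - by case.
  - by rewrite big_ord0 !subrr mulr0 addr0.
have supS : has_sup S.
  by split; [exists a | exists b => x [/andP[]]].
pose z := sup S.
have zab : a <= z <= b.
  apply/andP; split; first exact: sup_upper_bound.
  by apply: ge_sup; [exists a | move=> x [/andP[]]].
(* A reachable [x] slightly to the left of the supremum [z] is carried past [z]: either [b] is hit,
   or [z + r / 2] contradicts the supremum. *)
have [r r0 rP] := loc z zab.
have [x [/andP[ax xb] rx] zrx] := sup_adherent r0 supS.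
have xz : x <= z by apply: (sup_upper_bound supS); split; rewrite ?ax.
have reachb : reach f a (c + eps) U b.
  have [bzr|zrb] := ltP b (z + r); first by apply: rP rx => //; lra.
  have : S (z + r / 2).
    by split; [lra | apply: rP rx => //; lra].
  by move/(sup_upper_bound supS) => /=; rewrite -/z; lra.
have [N [s [t [st tr]]]] := reachb.
have /= : \sum_i `|f (t i) - f (s i)| < eps.
  apply: acP => //; first by move=> i; have [] := st i.
  by apply: sum_length_le Ud _ _ => // i; have [] := st i.
lra.
Qed.

(** Common source of the closure properties below: sums and opposites with [K = 1], constants with
    [K = 0], products with [K] a sum of bounds on the factors, functions with bounded derivative
    with [f1 = f2 = id]. *)
Lemma real_abs_continuous_lipschitz (R : realType) (a b K : R) (f1 f2 g : R -> R) :
  real_abs_continuous a b f1 -> real_abs_continuous a b f2 -> 0 <= K ->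
  (forall s t, a <= s -> s <= t -> t <= b ->
     `|g t - g s| <= K * (`|f1 t - f1 s| + `|f2 t - f2 s|)) ->
  real_abs_continuous a b g.
Proof.
move=> ac1 ac2 K0 gP eps eps0.
have e0 : 0 < eps / (2 * K + 1) by rewrite divr_gt0 //; lra.
have [d1 d10 P1] := ac1 _ e0; have [d2 d20 P2] := ac2 _ e0.
exists (Num.min d1 d2); first by rewrite lt_min d10.
move=> N s t st tr; rewrite lt_min => /andP[l1 l2].
have {P1 P2} := conj (P1 N s t st tr l1) (P2 N s t st tr l2).
have : eps / (2 * K + 1) * (2 * K + 1) = eps by rewrite divfK // gt_eqF //; lra.
move: (eps / (2 * K + 1)) e0 => e1 e10 e1E [h1 h2].
apply: (@le_lt_trans _ _ (K * (\sum_i `|f1 (t i) - f1 (s i)| + \sum_i `|f2 (t i) - f2 (s i)|))).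
  rewrite -big_split /= mulr_sumr; apply: ler_sum => i _.
  by have [? [? ?]] := st i; apply: gP.
apply: (@le_lt_trans _ _ (K * (e1 + e1))).
  by apply: ler_wpM2l => //; lra.
nra.
Qed.

Lemma real_abs_continuous_id (R : realType) (a b : R) : real_abs_continuous a b id.
Proof.
move=> eps eps0; exists eps => // N s t st _ lt; rewrite (eq_bigr (fun i => t i - s i)) // => i _.
by rewrite ger0_norm // subr_ge0; have [_ []] := st i.
Qed.

Lemma real_abs_continuousD (R : realType) (a b : R) (f g : R -> R) :
  real_abs_continuous a b f -> real_abs_continuous a b g ->
  real_abs_continuous a b (fun t => f t + g t).
Proof.
move=> acf acg; apply: (real_abs_continuous_lipschitz acf acg (@ler01 R)) => s t _ _ _.
by rewrite mul1r opprD addrACA ler_normD.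
Qed.

Lemma real_abs_continuousN (R : realType) (a b : R) (f : R -> R) :
  real_abs_continuous a b f -> real_abs_continuous a b (fun t => - f t).
Proof.
move=> acf; apply: (real_abs_continuous_lipschitz acf acf (@ler01 R)) => s t _ _ _.
by rewrite mul1r -opprD normrN lerDl.
Qed.

Lemma real_abs_continuous_cst (R : realType) (a b c : R) : real_abs_continuous a b (fun=> c).
Proof.
have acid := @real_abs_continuous_id R a b.
apply: (real_abs_continuous_lipschitz acid acid (lexx 0)) => s t _ _ _.
by rewrite subrr normr0 mul0r.
Qed.

(** Absolute continuity with tolerance 1 and a single interval bounds the change of [f] over a step
    of length [d / 2]; finitely many such steps cover [[a, b]]. *)
Lemma real_abs_continuous_bounded (R : realType) (a b : R) (f : R -> R) :
  real_abs_continuous a b f -> exists2 M, 0 <= M & forall t, a <= t <= b -> `|f t| <= M.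
Proof.
move=> /(_ _ (@ltr01 R))[d d0 dP].
have step s t : a <= s -> s <= t -> t <= b -> t - s < d -> `|f t - f s| < 1.
  move=> as_ st tb tsd; have := dP 1%N (fun=> s) (fun=> t).
  by rewrite !big_ord1; apply => // i j _ _ _; rewrite !ord1.
have chain (k : nat) t : a <= t <= b -> t - a <= k%:R * (d / 2) -> `|f t - f a| <= k%:R.
  elim: k t => [|k IH] t /andP[at_ tb]; rewrite ?mul0r => ht.
    have -> : t = a by apply/eqP; rewrite eq_le at_ -subr_le0 ht.
    by rewrite subrr normr0.
  move: ht; rewrite -natr1 mulrDl mul1r => ht.
  have [ta|ta] := leP (t - a) (d / 2).
    have := step a t (lexx _) at_ tb; have : 0 <= k%:R :> R by [].
    by move=> ? /(_ _)/ltW; lra.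
  have h1 : a <= t - d / 2 <= b by lra.
  have h2 : t - d / 2 - a <= k%:R * (d / 2) by lra.
  have := IH _ h1 h2; have := step (t - d / 2) t.
  move=> /(_ ltac:(lra) ltac:(lra) tb ltac:(lra)).
  have := ler_normD (f t - f (t - d / 2)) (f (t - d / 2) - f a).
  by rewrite addrA subrK; lra.
have d20 : 0 < d / 2 by lra.
pose k := Num.Def.trunc ((b - a) / (d / 2)).
exists (`|f a| + k.+1%:R) => [|t tab]; first by rewrite addr_ge0.
have : t - a <= k.+1%:R * (d / 2).
  rewrite -ler_pdivrMr //; apply: le_trans (ltW (truncnS_gt _)).
  by rewrite ler_pM2r ?invr_gt0 //; move: tab => /andP[_ ?]; lra.
move=> /(chain _ _ tab); have := ler_normD (f t - f a) (f a).
by rewrite subrK; lra.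
Qed.

Lemma real_abs_continuousM (R : realType) (a b : R) (f g : R -> R) :
  real_abs_continuous a b f -> real_abs_continuous a b g ->
  real_abs_continuous a b (fun t => f t * g t).
Proof.
move=> acf acg.
have [M M0 fM] := real_abs_continuous_bounded acf.
have [N N0 gN] := real_abs_continuous_bounded acg.
apply: (real_abs_continuous_lipschitz acf acg (addr_ge0 M0 N0)) => s t as_ st tb.
have -> : f t * g t - f s * g s = f t * (g t - g s) + (f t - f s) * g s by lra.
apply: le_trans (ler_normD _ _) _; rewrite !normrM.
have ft : `|f t| <= M by apply: fM; lra.
have gs : `|g s| <= N by apply: gN; lra.
have := normr_ge0 (f t - f s); have := normr_ge0 (g t - g s).
move: (`|f t - f s|) (`|g t - g s|) (`|f t|) (`|g s|) ft gs => u v x y xM yN v0 u0.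
have : x * v <= M * v by rewrite ler_wpM2r.
have : u * y <= u * N by rewrite ler_wpM2l.
have : 0 <= M * u by rewrite mulr_ge0.
have : 0 <= N * v by rewrite mulr_ge0.
lra.
Qed.

Lemma real_abs_continuous_sum (R : realType) (a b : R) (n : nat) (f : 'I_n -> R -> R) :
  (forall i, real_abs_continuous a b (f i)) ->
  real_abs_continuous a b (fun t => \sum_i f i t).
Proof.
elim: n f => [|n IH] f acf.
  by under eq_fun do rewrite big_ord0; exact: real_abs_continuous_cst.
under eq_fun do rewrite big_ord_recl.
apply: (@real_abs_continuousD _ _ _ (f ord0) (fun t => \sum_i f (lift ord0 i) t)) => //.
exact: IH.
Qed.

Lemma real_abs_continuous_derivable (R : realType) (a b K : R) (f df : R -> R) :
  (forall t, is_derive t (1 : R) f (df t)) -> 0 <= K ->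
  (forall t, a <= t <= b -> `|df t| <= K) -> real_abs_continuous a b f.
Proof.
move=> fP K0 dfK; have acid := @real_abs_continuous_id R a b.
apply: (real_abs_continuous_lipschitz acid acid K0) => s t as_ st tb.
have [|c cst ->] := @MVT_segment R f df s t st (fun x _ => fP x).
  apply: derivable_within_continuous => x _; by have [] := fP x.
rewrite normrM; apply: le_trans (_ : K * `|t - s| <= _).
  rewrite ler_wpM2r //; apply: dfK; move: cst; rewrite in_itv /=; lra.
by rewrite ler_wpM2l // lerDl.
Qed.

Lemma real_abs_continuous_coord (R : realType) (p : nat) (a b : R) (f : R -> 'cV[R]_p) i :
  abs_continuous a b f -> real_abs_continuous a b (fun t => f t i 0).
Proof.
move=> acf eps /acf[d d0 dP]; exists d => // N s t st tr std.
apply: le_lt_trans (dP N s t st tr std); apply: ler_sum => k _.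
rewrite /enorm -sqrtr_sqr ler_sqrt; last by apply: sumr_ge0 => j _; exact: sqr_ge0.
rewrite (bigD1 i) //= !mxE lerDl; apply: sumr_ge0 => j _; exact: sqr_ge0.
Qed.

Lemma ae_lebesgueS (R : realType) (P Q : R -> Prop) : (forall x, P x -> Q x) ->
  {ae lebesgue_measure, forall t : R, P t} -> {ae lebesgue_measure, forall t : R, Q t}.
Proof.
by move=> PQ [A [mA A0 AP]]; exists A; split => // x nQ; apply: AP => /PQ.
Qed.

Lemma ae_derive_norm_le (R : realType) (f : R -> R) (a b c : R) :
  a <= b -> 0 <= c -> real_abs_continuous a b f ->
  {ae lebesgue_measure, forall t : R, a < t < b ->
     exists2 d, is_derive t (1 : R) f d & `|d| <= c} ->
  `|f b - f a| <= c * (b - a).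
Proof.
move=> ab c0 acf fP; rewrite ler_norml; apply/andP; split.
  have := @ae_derive_le_growth R (fun t => - f t) a b c ab c0 (real_abs_continuousN acf).
  rewrite opprK => H; suff : - f b + f a <= c * (b - a) by lra.
  apply: H; apply: ae_lebesgueS fP => t tP /tP[d df]; rewrite ler_norml => /andP[dc _].
  by exists (- d); [exact: is_deriveN | lra].
apply: (ae_derive_le_growth ab c0 acf).
apply: ae_lebesgueS fP => t tP /tP[d df]; rewrite ler_norml => /andP[_ dc].
by exists d.
Qed.

Lemma ae_derive0_cst (R : realType) (f : R -> R) (a b : R) :
  a <= b -> real_abs_continuous a b f ->
  {ae lebesgue_measure, forall t : R, a < t < b -> is_derive t (1 : R) f 0} ->
  f b = f a.
Proof.
move=> ab acf fP; apply/eqP; rewrite -subr_eq0 -normr_le0.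
rewrite -(mul0r (b - a)); apply: ae_derive_norm_le => //.
by apply: ae_lebesgueS fP => t tP /tP df; exists 0; rewrite ?normr0.
Qed.

(** * Quadratic forms *)

Lemma coord_le_norm (R : realType) (p q : nat) (x : 'M[R]_(p, q)) i j : `|x i j| <= `|x|.
Proof. by rewrite [leRHS]/Num.norm /= mx_normrE; exact: (le_bigmax _ _ (i, j)). Qed.

Lemma norm_le_coord (R : realType) (p q : nat) (x : 'M[R]_(p, q)) (C : R) :
  0 <= C -> (forall i j, `|x i j| <= C) -> `|x| <= C.
Proof.
by move=> C0 xC; rewrite [leLHS]/Num.norm /= mx_normrE; apply: bigmax_le => // i _.
Qed.

Lemma norm_trmx (R : realType) (p q : nat) (x : 'M[R]_(p, q)) : `|x^T| = `|x|.
Proof.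
apply/eqP; rewrite eq_le; apply/andP; split; apply: norm_le_coord => // i j.
  by rewrite mxE coord_le_norm.
by have := coord_le_norm x^T j i; rewrite mxE.
Qed.

Lemma norm_mulmx (R : realType) (p q r : nat) (A : 'M[R]_(p, q)) (x : 'M[R]_(q, r)) :
  `|A *m x| <= q%:R * `|A| * `|x|.
Proof.
apply: norm_le_coord => [|i j]; first by rewrite !mulr_ge0.
rewrite mxE; apply: le_trans (ler_norm_sum _ _ _) _.
apply: (@le_trans _ _ (\sum_(k < q) `|A| * `|x|)).
  by apply: ler_sum => k _; rewrite normrM ler_pM ?coord_le_norm.
by rewrite sumr_const card_ord -mulrA mulr_natl.
Qed.

Lemma norm_col_mx (R : realType) (p q : nat) (x : 'cV[R]_p) (y : 'cV[R]_q) :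
  `|col_mx x y| <= `|x| + `|y|.
Proof.
apply: norm_le_coord => [|i j]; first by rewrite addr_ge0.
rewrite mxE; case: (fintype.split i) => k; apply: le_trans (coord_le_norm _ k j) _.
  by rewrite lerDl.
by rewrite lerDr.
Qed.

Lemma norm_usubmx (R : realType) (p q : nat) (x : 'cV[R]_(p + q)) : `|usubmx x| <= `|x|.
Proof. by apply: norm_le_coord => // i j; rewrite mxE coord_le_norm. Qed.

Lemma norm_dsubmx (R : realType) (p q : nat) (x : 'cV[R]_(p + q)) : `|dsubmx x| <= `|x|.
Proof. by apply: norm_le_coord => // i j; rewrite mxE coord_le_norm. Qed.

Lemma norm_le_enorm (R : realType) (p : nat) (x : 'cV[R]_p) : `|x| <= enorm x.
Proof.
apply: norm_le_coord => [|i j]; rewrite ?sqrtr_ge0 // ord1 -sqrtr_sqr ler_sqrt.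
  by rewrite (bigD1 i) //= lerDl; apply: sumr_ge0 => k _; exact: sqr_ge0.
by apply: sumr_ge0 => k _; exact: sqr_ge0.
Qed.

Lemma enorm_le_norm (R : realType) (p : nat) (x : 'cV[R]_p) : enorm x <= p%:R * `|x|.
Proof.
have -> : p%:R * `|x| = Num.sqrt ((p%:R * `|x|) ^+ 2) by rewrite sqrtr_sqr ger0_norm ?mulr_ge0.
rewrite ler_sqrt ?sqr_ge0 //.
apply: (@le_trans _ _ (\sum_(i < p) `|x| ^+ 2)).
  apply: ler_sum => i _; rewrite -(real_normK (num_real (x i 0))) lerXn2r ?nnegrE ?coord_le_norm //.
rewrite sumr_const card_ord -[leLHS]mulr_natl exprMn ler_wpM2r ?sqr_ge0 //.
rewrite expr2 -natrM ler_nat; case: p {x} => // p; exact: leq_pmulr.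
Qed.

Lemma qform_le_norm (R : realType) (p : nat) (A : 'M[R]_p) :
  exists2 C, 0 < C & forall x, qform A x <= C * `|x| ^+ 2.
Proof.
exists (p%:R * (p%:R * `|A|) + 1); first by rewrite ltr_wpDl // !mulr_ge0.
move=> x; rewrite /qform; apply: le_trans (ler_norm _) _.
apply: le_trans (coord_le_norm _ _ _) _; apply: le_trans (norm_mulmx _ _) _.
have := norm_mulmx x^T A; rewrite norm_trmx => h.
have : p%:R * `|x^T *m A| * `|x| <= p%:R * (p%:R * `|x| * `|A|) * `|x|.
  by apply: ler_wpM2r => //; apply: ler_wpM2l.
have := sqr_ge0 (`|x|); lra.
Qed.

Lemma qform_sum (R : realType) (p : nat) (A : 'M[R]_p) (x : 'cV[R]_p) :
  qform A x = \sum_j \sum_i x i 0 * A i j * x j 0.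
Proof.
rewrite /qform mxE; apply: eq_bigr => j _; rewrite mxE mulr_suml.
by apply: eq_bigr => i _; rewrite mxE.
Qed.

Lemma qformZ (R : realType) (p : nat) (A : 'M[R]_p) (a : R) (x : 'cV[R]_p) :
  qform A (a *: x) = a ^+ 2 * qform A x.
Proof.
have aT : (a *: x)^T = a *: x^T by apply/matrixP => i j; rewrite !mxE.
by rewrite /qform aT -!scalemxAl -scalemxAr scalerA mxE.
Qed.

Lemma qform0 (R : realType) (p : nat) (A : 'M[R]_p) : qform A 0 = 0.
Proof. by rewrite /qform mulmx0 mxE. Qed.

(** The form attains a positive minimum on the compact unit sphere, and homogeneity extends the
    bound to all vectors. *)
Lemma qform_coercive (R : realType) (p : nat) (A : 'M[R]_p) :
  (forall x : 'cV[R]_p, x != 0 -> 0 < qform A x) ->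
  exists2 c, 0 < c & forall x, c * `|x| ^+ 2 <= qform A x.
Proof.
move=> Apos; pose S := [set v : 'rV[R]_p | `|v| = 1].
have unitS (x : 'cV[R]_p) : x != 0 -> S (`|x|^-1 *: x)^T.
  by move=> x0; rewrite /S /= norm_trmx normrZ ger0_norm // mulVf ?normr_eq0.
(* The sphere is empty in dimension 0, which occurs for a graph with one node; every vector is then
   0 and any constant works. *)
have [[v0 Sv0]|S0] := pselect (S !=set0); last first.
  exists 1 => // x; have [->|/unitS Sx] := eqVneq x 0; last by case: S0; exists (`|x|^-1 *: x)^T.
  by rewrite qform0 normr0 expr0n mulr0.
have cS : compact S.
  apply: bounded_closed_compact.
    by exists 1; split => // M M1 v /= ->; exact: ltW.
  rewrite (_ : S = Num.norm @^-1` [set 1 : R]) //.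
  by apply: closed_comp; [move=> v _; exact: norm_continuous | exact: closed_eq].
have cf : continuous (fun v : 'rV[R]_p => qform A v^T).
  under eq_fun do rewrite qform_sum.
  move=> v; have Fv : Filter (nbhs v) by exact: nbhs_filter.
  apply: cvg_big => [|j _]; first exact: add_continuous.
  apply: cvg_big => [|i _]; first exact: add_continuous.
  have cE k : (fun x : 'rV[R]_p => x^T k 0) = (fun x : 'rV[R]_p => x 0 k).
    by apply/funext => x; rewrite mxE.
  apply: cvgM; [apply: cvgM; [|exact: cvg_cst]|].
    by rewrite cE mxE; exact: coord_continuous.
  by rewrite cE mxE; exact: coord_continuous.
have [u uS uP] := EVT_min_rV (ex_intro _ v0 Sv0) cS (continuous_subspaceT cf).
have u0 : u^T != 0.
  apply/eqP => u0; move: uS; rewrite inE /S /= -norm_trmx u0 normr0 => /eqP.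
  by rewrite eq_sym oner_eq0.
exists (qform A u^T); first exact: Apos.
move=> x; have [->|x0] := eqVneq x 0; first by rewrite qform0 normr0 expr0n mulr0.
have := uP (`|x|^-1 *: x)^T; rewrite trmxK qformZ => h.
have nx : 0 < `|x| ^+ 2 by rewrite exprn_gt0 // normr_gt0.
have : qform A u^T <= `|x|^-1 ^+ 2 * qform A x by apply: h; rewrite inE; exact: unitS.
by rewrite exprVn [X in _ <= X]mulrC ler_pdivlMr.
Qed.

(** For positive definite [P] this is a norm: its triangle inequality lets disturbances add
    linearly, and its convexity handles intermediate values of the reset timer. *)
Definition pnorm (R : realType) (p : nat) (P : 'M[R]_p) (x : 'cV[R]_p) : R :=
  Num.sqrt (qform P x).

Lemma qform_ge0 (R : realType) (p : nat) (P : 'M[R]_p) (x : 'cV[R]_p) :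
  sym_posdef P -> 0 <= qform P x.
Proof.
by move=> [_ Pp]; have [->|/Pp/ltW//] := eqVneq x 0; rewrite qform0.
Qed.

Lemma pnorm_ge0 (R : realType) (p : nat) (P : 'M[R]_p) (x : 'cV[R]_p) : 0 <= pnorm P x.
Proof. exact: sqrtr_ge0. Qed.

Lemma pnormZ (R : realType) (p : nat) (P : 'M[R]_p) (a : R) (x : 'cV[R]_p) :
  pnorm P (a *: x) = `|a| * pnorm P x.
Proof. by rewrite /pnorm qformZ sqrtrM ?sqr_ge0 // sqrtr_sqr. Qed.

Lemma qform_lin (R : realType) (p : nat) (P : 'M[R]_p) (a : R) (x y : 'cV[R]_p) :
  P^T = P ->
  qform P (x + a *: y) = qform P x + 2 * a * (x^T *m P *m y) 0 0 + a ^+ 2 * qform P y.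
Proof.
move=> PT; rewrite /qform.
have -> : (x + a *: y)^T = x^T + a *: y^T by apply/matrixP => i j; rewrite !mxE.
rewrite !mulmxDl !mulmxDr -!scalemxAl -!scalemxAr.
have -> : y^T *m P *m x = x^T *m P *m y.
  rewrite [LHS](_ : _ = (y^T *m P *m x)^T); last by apply/matrixP => i j; rewrite !ord1 [RHS]mxE.
  by rewrite !trmx_mul trmxK PT mulmxA.
move: (x^T *m P *m x) (x^T *m P *m y) (y^T *m P *m y) => A B C; rewrite !mxE; lra.
Qed.

Lemma qform_CS (R : realType) (p : nat) (P : 'M[R]_p) (x y : 'cV[R]_p) :
  sym_posdef P -> (x^T *m P *m y) 0 0 <= pnorm P x * pnorm P y.
Proof.
move=> Pp; have [PT Ppos] := Pp.
have [->|y0] := eqVneq y 0.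
  by rewrite mulmx0 mxE mulr_ge0 ?pnorm_ge0.
have qy := Ppos y y0; set b := (x^T *m P *m y) 0 0.
(* The coefficient minimises the form on the line [x + a *: y]; the minimum [r - b ^+ 2 / q] is
   nonnegative. *)
have := qform_ge0 (x + (- b / qform P y) *: y) Pp.
rewrite qform_lin // -/b => h.
rewrite /pnorm -sqrtrM ?qform_ge0 //; apply: le_trans (ler_norm b) _.
rewrite -sqrtr_sqr ler_sqrt ?mulr_ge0 ?qform_ge0 //.
move: h; set q := qform P y in qy *; set r := qform P x.
have -> : r + 2 * (- b / q) * b + (- b / q) ^+ 2 * q = r - b ^+ 2 / q by field; rewrite gt_eqF.
by rewrite subr_ge0 ler_pdivrMr.
Qed.

Lemma pnormD (R : realType) (p : nat) (P : 'M[R]_p) (x y : 'cV[R]_p) :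
  sym_posdef P -> pnorm P (x + y) <= pnorm P x + pnorm P y.
Proof.
move=> Pp; have h0 : 0 <= pnorm P x + pnorm P y by rewrite addr_ge0 ?pnorm_ge0.
rewrite -[leRHS]ger0_norm // -sqrtr_sqr ler_sqrt ?sqr_ge0 //.
have := qform_CS x y Pp; have := qform_lin 1 x y Pp.1; rewrite scale1r => ->.
by rewrite sqrrD !sqr_sqrtr ?qform_ge0 //; lra.
Qed.

Lemma pnorm_equiv (R : realType) (p : nat) (P : 'M[R]_p) : sym_posdef P ->
  exists c C, [/\ 0 < c, 0 < C & forall x, c * `|x| <= pnorm P x <= C * `|x|].
Proof.
move=> Pp; have [c c0 cP] := qform_coercive Pp.2; have [C C0 CP] := qform_le_norm P.
exists (Num.sqrt c), (Num.sqrt C); rewrite !sqrtr_gt0; split => // x.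
have e a : 0 < a -> Num.sqrt a * `|x| = Num.sqrt (a * `|x| ^+ 2).
  by move=> a0; rewrite sqrtrM ?ltW // sqrtr_sqr normr_id.
by rewrite !e // /pnorm !ler_wsqrtr.
Qed.

Lemma qform_mulmx (R : realType) (p q : nat) (P : 'M[R]_p) (M : 'M[R]_(p, q)) (x : 'cV[R]_q) :
  qform P (M *m x) = qform (M^T *m P *m M) x.
Proof. by rewrite /qform trmx_mul !mulmxA. Qed.

Lemma qformB (R : realType) (p : nat) (P Q : 'M[R]_p) (x : 'cV[R]_p) :
  qform (P - Q) x = qform P x - qform Q x.
Proof. by rewrite /qform mulmxBr mulmxBl !mxE. Qed.

Lemma qformD (R : realType) (p : nat) (P Q : 'M[R]_p) (x : 'cV[R]_p) :
  qform (P + Q) x = qform P x + qform Q x.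
Proof. by rewrite /qform mulmxDr mulmxDl !mxE. Qed.

Lemma qform_scalar (R : realType) (p : nat) (b : R) (x : 'cV[R]_p) :
  qform (- b%:M) x = - b * \sum_i x i 0 ^+ 2.
Proof.
rewrite /qform mulmxN mulNmx mul_mx_scalar -scalemxAl !mxE mulNr; congr (- (_ * _)).
by apply: eq_bigr => i _; rewrite mxE expr2.
Qed.

(** The decrease [P - M^T P M] is coercive, hence at least a fixed fraction of [qform P x]. *)
Lemma uniform_contraction (R : realType) (p : nat) (P M : 'M[R]_p) : sym_posdef P ->
  (forall x : 'cV[R]_p, x != 0 -> qform P (M *m x) < qform P x) ->
  exists2 r, 0 <= r < 1 & forall x, pnorm P (M *m x) <= r * pnorm P x.
Proof.
move=> Pp MP.
have [x x0|c c0 cP] := @qform_coercive _ _ (P - M^T *m P *m M).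
  by rewrite qformB -qform_mulmx subr_gt0 MP.
have [C C0 CP] := qform_le_norm P.
have C'0 : 0 < C + c by lra.
have r0 : 0 <= 1 - c / (C + c) by rewrite subr_ge0 ler_pdivrMr //; lra.
have r1 : 1 - c / (C + c) < 1 by rewrite ltrBlDr ltrDl divr_gt0.
(* Dividing by [C + c] rather than [C] keeps the radicand nonnegative without comparing [c] to
   [C]. *)
exists (Num.sqrt (1 - c / (C + c))).
  by rewrite sqrtr_ge0 -[ltRHS]sqrtr1 ltr_sqrt ?ltr01.
move=> x; rewrite /pnorm -sqrtrM // ler_wsqrtr //.
have := cP x; rewrite qformB -qform_mulmx => h1.
have h2 : qform P x / (C + c) <= `|x| ^+ 2.
  rewrite ler_pdivrMr //; have := CP x; have := sqr_ge0 (`|x|); nra.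
have : c * (qform P x / (C + c)) <= c * `|x| ^+ 2 by rewrite ler_pM2l.
lra.
Qed.

(** * The matrix exponential of A_f2 *)

(* The integral of [expR (h * s)] over [0 <= s <= nu]. *)
Definition expR_int (R : realType) (h nu : R) : R := if h == 0 then nu else (expR (h * nu) - 1) / h.

Lemma scaled_exp (R : realType) (p : nat) (h nu : R) (B : 'M[R]_p) (k : nat) :
  B *m B = h *: B -> (nu *: B) ^+ k.+1 = (nu ^+ k.+1 * h ^+ k) *: B.
Proof.
move=> BB; elim: k => [|k IH]; first by rewrite !expr1 mulr1.
rewrite exprS IH -[_ * _]/((nu *: B) *m ((nu ^+ k.+1 * h ^+ k) *: B)).
rewrite -scalemxAl -scalemxAr BB !scalerA; congr (_ *: _).
by rewrite !exprS; ring.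
Qed.

(** Since [B ^+ k.+1 = h ^+ k *: B], only a scalar series multiplies [B]. Stated for any such [B],
    it covers both [A_f2] and its transpose. *)
Lemma expm_scaled (R : realType) (p : nat) (h nu : R) (B : 'M[R]_p) :
  B *m B = h *: B -> expm (nu *: B) = 1%:M + expR_int h nu *: B.
Proof.
move=> BB; rewrite /expm; apply: cvg_lim => //; rewrite -cvg_shiftS /=.
(* Coefficient of [B] in the partial sum up to order [n]. For [h = 0] only the first-order term
   survives, and it is absent at [n = 0]; otherwise it is the truncated exponential without its
   constant term, divided by [h]. *)
pose s n : R := if h == 0 then (n != 0%N)%:R * nu else (series (exp_coeff (h * nu)) n.+1 - 1) / h.
have -> : (fun n => series (fun k => (k`!%:R : R)^-1 *: (nu *: B) ^+ k) n.+1) =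
          (fun n => 1%:M + s n *: B).
  apply/funext; elim => [|n IH].
    rewrite seriesSr /series /= big_geq // add0r fact0 invr1 scale1r expr0.
    rewrite /s /series /= big_nat1 /exp_coeff /= expr0 fact0 invr1 mulr1 subrr !mul0r if_same.
    by rewrite scale0r addr0.
  rewrite seriesSr IH (scaled_exp nu n BB) scalerA -addrA -scalerDl; congr (_ + _ *: _).
  rewrite /s; case: eqVneq => [->|h0].
    case: n {IH} => [|n]; last by rewrite expr0n /= mulr0 mulr0 addr0.
    by rewrite mul0r add0r mulr1 expr1 invr1 !mul1r.
  rewrite [in RHS]seriesSr /exp_coeff /= exprMn [(h ^+ n.+1)]exprSr.
  have f0 : (n.+1)`!%:R != 0 :> R by rewrite pnatr_eq0 -lt0n fact_gt0.
  by field; rewrite f0 h0.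
apply: cvgD; first exact: cvg_cst.
apply: cvgZr_tmp.
rewrite /s /expR_int; case: eqVneq => [_|h0].
  rewrite -cvg_shiftS /=; under eq_fun do rewrite mul1r; exact: cvg_cst.
apply: cvgM; last exact: cvg_cst.
apply: cvgB; last exact: cvg_cst.
rewrite cvg_shiftS; exact: is_cvg_series_exp_coeff.
Qed.

(** * Flows *)

Lemma is_derive_coord (R : realType) (p : nat) (f : R -> 'cV[R]_p) (t : R) (df : 'cV[R]_p) i :
  is_derive t (1 : R) f df -> is_derive t (1 : R) (fun s => f s i 0) (df i 0).
Proof.
move=> [fd fE]; apply: DeriveDef; first exact: ((derivable_mxP _ _ _).1 fd).
by rewrite -fE derive_mx // mxE.
Qed.

Lemma is_derive_qform (R : realType) (p : nat) (P : 'M[R]_p) (f : R -> 'cV[R]_p) (t : R)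
    (df : 'cV[R]_p) :
  (forall i, is_derive t (1 : R) (fun s => f s i 0) (df i 0)) ->
  is_derive t (1 : R) (fun s => qform P (f s))
    ((df^T *m P *m f t) 0 0 + ((f t)^T *m P *m df) 0 0).
Proof.
move=> fP.
have -> : (fun s => qform P (f s)) =
    \sum_j \sum_i ((fun s => f s i 0) * cst (P i j) * (fun s => f s j 0)).
  apply/funext => s; rewrite qform_sum fct_sumE; apply: eq_bigr => j _.
  by rewrite fct_sumE.
apply: is_derive_eq.
rewrite !mxE -big_split; apply: eq_bigr => j _ /=; rewrite !mxE !mulr_suml -big_split /=.
apply: eq_bigr => i _; rewrite !mxE /GRing.scale /=.
by rewrite -[(_ * cst (P i j)) t]/(f t i 0 * P i j); ring.
Qed.

Lemma real_abs_continuous_qform (R : realType) (p : nat) (P : 'M[R]_p) (f : R -> 'cV[R]_p)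
    (a b : R) :
  (forall i, real_abs_continuous a b (fun s => f s i 0)) ->
  real_abs_continuous a b (fun s => qform P (f s)).
Proof.
move=> acf; under eq_fun do rewrite qform_sum.
apply: (real_abs_continuous_sum (f := fun j s => \sum_i f s i 0 * P i j * f s j 0)) => j.
apply: (real_abs_continuous_sum (f := fun i s => f s i 0 * P i j * f s j 0)) => i.
apply: (@real_abs_continuousM _ _ _ (fun s => f s i 0 * P i j)) => //.
by apply: real_abs_continuousM => //; exact: real_abs_continuous_cst.
Qed.

Lemma is_derive_expR_scale (R : realType) (k t : R) :
  is_derive t (1 : R) (fun s => expR (k * s)) (k * expR (k * t)).
Proof.
have H : is_derive t (1 : R) (fun s : R => k * s) k.
  by apply: is_derive_eq; rewrite /GRing.scale /= mulr1. 
have := @is_derive1_comp R expR (fun s => k * s) t _ _ (is_derive_expR _) H.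
by rewrite [k * expR _]mulrC; exact.
Qed.

Lemma real_abs_continuous_expR (R : realType) (k a b : R) :
  real_abs_continuous a b (fun s => expR (k * s)).
Proof.
apply: (@real_abs_continuous_derivable _ _ _ (`|k| * expR (`|k| * (`|a| + `|b|)))
          _ _ (is_derive_expR_scale k)); first by rewrite mulr_ge0 ?expR_ge0.
move=> t /andP[at_ tb]; rewrite normrM (ger0_norm (expR_ge0 _)) ler_wpM2l // ler_expR.
apply: le_trans (ler_norm _) _; rewrite normrM ler_wpM2l // ler_norml.
have := ler_norm b; have := ler_norm (- a); rewrite normrN.
have := normr_ge0 a; have := normr_ge0 b; lra.
Qed.

(** With the integrating factor [expR (k * t)], the weighted Lyapunov function has a nonpositive
    derivative almost everywhere. *)
Lemma lyapunov_flow (R : realType) (p : nat) (P A : 'M[R]_p) (k : R) (f : R -> 'cV[R]_p)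
    (a b : R) :
  (forall x, qform (P *m A + A^T *m P) x <= - k * qform P x) ->
  a <= b -> (forall i, real_abs_continuous a b (fun s => f s i 0)) ->
  {ae lebesgue_measure, forall t : R, a < t < b ->
     forall i, is_derive t (1 : R) (fun s => f s i 0) ((A *m f t) i 0)} ->
  expR (k * b) * qform P (f b) <= expR (k * a) * qform P (f a).
Proof.
move=> lyap ab acf fP.
have := @ae_derive_le_growth R (fun t => expR (k * t) * qform P (f t)) a b 0 ab (lexx 0).
rewrite mul0r subr_le0; apply.
  apply: real_abs_continuousM; first exact: real_abs_continuous_expR.
  by apply: real_abs_continuous_qform.
apply: ae_lebesgueS fP => t tP /tP /(is_derive_qform P) dq.
exists (expR (k * t) * qform (P *m A + A^T *m P) (f t) + k * expR (k * t) * qform P (f t)).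
  apply: (@is_derive_eq _ _ _ _ _ _ _ _ (is_deriveM (is_derive_expR_scale k t) dq)).
  rewrite qformD /qform trmx_mul !mulmxA /GRing.scale /=; ring.
have := lyap (f t); have := expR_gt0 (k * t); nra.
Qed.

Lemma lyapunov_rate (R : realType) (p : nat) (P A : 'M[R]_p) (b : R) :
  sym_posdef P -> 0 < b -> loewner_le (P *m A + A^T *m P) (- b%:M) ->
  exists2 k, 0 < k & forall x, qform (P *m A + A^T *m P) x <= - k * qform P x.
Proof.
move=> Pp b0 PA; have [C C0 CP] := qform_le_norm P.
exists (b / C); first exact: divr_gt0.
move=> x; apply: le_trans (PA x) _; rewrite qform_scalar !mulNr lerN2.
have h1 : `|x| ^+ 2 <= \sum_i x i 0 ^+ 2.
  have s0 : 0 <= \sum_i x i 0 ^+ 2 by apply: sumr_ge0 => i _; exact: sqr_ge0.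
  rewrite -[leRHS](sqr_sqrtr s0) lerXn2r ?nnegrE ?sqrtr_ge0 //; exact: norm_le_enorm.
have : qform P x / C <= \sum_i x i 0 ^+ 2.
  by rewrite ler_pdivrMr // mulrC; apply: le_trans (CP x) _; rewrite ler_pM2l.
by rewrite mulrAC -mulrA ler_pM2l.
Qed.

Lemma expR_int0 (R : realType) (h : R) : expR_int h 0 = 0.
Proof. by rewrite /expR_int; case: eqP => // _; rewrite mulr0 expR0 subrr mul0r. Qed.

Lemma expR_expR_int (R : realType) (h nu : R) : expR (h * nu) = 1 + h * expR_int h nu.
Proof.
rewrite /expR_int; case: eqVneq => [->|h0]; first by rewrite !mul0r expR0 addr0.
by rewrite mulrCA mulfV // mulr1 addrC subrK.
Qed.

Lemma is_derive_expR_int (R : realType) (h nu : R) :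
  is_derive nu (1 : R) (expR_int h) (expR (h * nu)).
Proof.
rewrite /expR_int; case: eqVneq => [->|h0].
  by rewrite mul0r expR0; exact: is_derive_id.
have H := is_derive_expR_scale h nu.
have -> : (fun nu => (expR (h * nu) - 1) / h) = ((fun nu => expR (h * nu)) - cst 1) * cst h^-1.
  by apply/funext.
apply: is_derive_eq.
by rewrite /GRing.scale /= mulr0 add0r subr0 mulrA mulVf // mul1r.
Qed.

Lemma le_expR_int (R : realType) (h a b : R) : a <= b -> expR_int h a <= expR_int h b.
Proof.
move=> ab; have [||c _] := @MVT_segment R (expR_int h) (fun x => expR (h * x)) a b ab.
- by move=> x _; exact: is_derive_expR_int.
- by apply: derivable_within_continuous => x _; have [] := is_derive_expR_int h x.
- move=> E; rewrite -subr_ge0 E mulr_ge0 ?expR_ge0 //; lra.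
Qed.

(** Here [c] will be the instant at which the timer expires, so that [c - s] is the timer value at
    time [s]. *)
Lemma is_derive_expR_int_sub (R : realType) (h c t : R) :
  is_derive t (1 : R) (fun s => expR_int h (c - s)) (- expR (h * (c - t))).
Proof.
have H : is_derive t (1 : R) (fun s : R => c - s) (- 1).
  have -> : (fun s : R => c - s) = cst c - id by apply/funext.
  by apply: is_derive_eq; rewrite add0r.
have := @is_derive1_comp R (expR_int h) (fun s => c - s) t _ _ (is_derive_expR_int _ _) H.
by rewrite mulrN1; exact.
Qed.

Lemma real_abs_continuous_expR_int_sub (R : realType) (h c a b : R) :
  real_abs_continuous a b (fun s => expR_int h (c - s)).
Proof.
apply: (@real_abs_continuous_derivable _ _ _ (expR (`|h| * (`|c| + `|a| + `|b|)))
          _ _ (is_derive_expR_int_sub h c)); first exact: expR_ge0.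
move=> t /andP[at_ tb]; rewrite normrN (ger0_norm (expR_ge0 _)) ler_expR.
apply: le_trans (ler_norm _) _; rewrite normrM ler_wpM2l // ler_norml.
have := ler_norm b; have := ler_norm (- a); have := ler_norm c; have := ler_norm (- c).
have := ler_norm a; have := ler_norm (- b); rewrite !normrN.
have := normr_ge0 a; have := normr_ge0 b; lra.
Qed.

Definition coord_derive (R : realType) (p : nat) (t : R) (f : R -> 'cV[R]_p) (df : 'cV[R]_p) :=
  forall i, is_derive t (1 : R) (fun s => f s i 0) (df i 0).

Definition coord_abs_continuous (R : realType) (p : nat) (a b : R) (f : R -> 'cV[R]_p) :=
  forall i, real_abs_continuous a b (fun s => f s i 0).

Lemma coord_derive_usubmx (R : realType) (p q : nat) (t : R) (f : R -> 'cV[R]_(p + q)) df :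
  coord_derive t f df -> coord_derive t (fun s => usubmx (f s)) (usubmx df).
Proof. by move=> H i; rewrite mxE; under eq_fun do rewrite mxE; exact: H. Qed.

Lemma coord_derive_dsubmx (R : realType) (p q : nat) (t : R) (f : R -> 'cV[R]_(p + q)) df :
  coord_derive t f df -> coord_derive t (fun s => dsubmx (f s)) (dsubmx df).
Proof. by move=> H i; rewrite mxE; under eq_fun do rewrite mxE; exact: H. Qed.

Lemma coord_abs_continuous_usubmx (R : realType) (p q : nat) (a b : R) (f : R -> 'cV[R]_(p + q)) :
  coord_abs_continuous a b f -> coord_abs_continuous a b (fun s => usubmx (f s)).
Proof. by move=> H i; under eq_fun do rewrite mxE; exact: H. Qed.

Lemma coord_abs_continuous_dsubmx (R : realType) (p q : nat) (a b : R) (f : R -> 'cV[R]_(p + q)) :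
  coord_abs_continuous a b f -> coord_abs_continuous a b (fun s => dsubmx (f s)).
Proof. by move=> H i; under eq_fun do rewrite mxE; exact: H. Qed.

Definition flows_on (R : realType) (p q : nat) (H : hybrid_system R p q) (a b : R)
    (f : R -> 'cV[R]_p) (m : R -> 'cV[R]_q) : Prop :=
  [/\ abs_continuous a b f,
      forall t, a < t < b -> flow_set H (f t) &
      {ae lebesgue_measure, forall t : R, a < t < b ->
         is_derive t (1 : R) f (flow_map H (f t) (m t))}].

Lemma flows_onW (R : realType) (p q : nat) (H : hybrid_system R p q) (a b b' : R)
    (f : R -> 'cV[R]_p) (m : R -> 'cV[R]_q) :
  b' <= b -> flows_on H a b f m -> flows_on H a b' f m.
Proof.
move=> bb [acf fs fd]; split.
- move=> eps /acf[d d0 dP]; exists d => // N s t st; apply: dP => i.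
  by have [? [? ?]] := st i; split => //; split => //; apply: le_trans bb.
- by move=> t tab; apply: fs; lra.
- by apply: ae_lebesgueS fd => t tP tab; apply: tP; lra.
Qed.

Lemma eta_flow (R : realType) (h a b : R) (eta : R -> R) :
  a <= b -> real_abs_continuous a b eta ->
  {ae lebesgue_measure, forall t : R, a < t < b -> is_derive t (1 : R) eta (h * eta t)} ->
  eta b = expR (h * (b - a)) * eta a.
Proof.
move=> ab aceta etaP.
have E : expR (- h * b) * eta b = expR (- h * a) * eta a.
  apply: (@ae_derive0_cst R (fun s => expR (- h * s) * eta s) a b ab).
    by apply: real_abs_continuousM => //; exact: real_abs_continuous_expR.
  apply: ae_lebesgueS etaP => t tP /tP dt.
  apply: (@is_derive_eq _ _ _ _ _ _ _ _ (is_deriveM (is_derive_expR_scale (- h) t) dt)).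
  rewrite /GRing.scale /=; ring.
have -> : h * (b - a) = h * b + - h * a by ring.
by rewrite expRD -mulrA -E mulrA -expRD mulNr subrr expR0 mul1r.
Qed.

(** Differentiating [e + expR_int h (c - s) * eta] leaves exactly [u]: the terms in [eta] have
    coefficient [1 - expR (h * (c - s)) + h * expR_int h (c - s)], which is 0 by [expR_expR_int]. *)
Lemma predicted_flow (R : realType) (h c a b B : R) (e eta u : R -> R) :
  a <= b -> 0 <= B -> real_abs_continuous a b e -> real_abs_continuous a b eta ->
  {ae lebesgue_measure, forall t : R, a < t < b ->
     [/\ is_derive t (1 : R) e (eta t + u t), is_derive t (1 : R) eta (h * eta t) &
         `|u t| <= B]} ->
  `|(e b + expR_int h (c - b) * eta b) - (e a + expR_int h (c - a) * eta a)| <= B * (b - a).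
Proof.
move=> ab B0 ace aceta P.
apply: (@ae_derive_norm_le R (fun s => e s + expR_int h (c - s) * eta s) a b B ab B0).
  apply: real_abs_continuousD => //; apply: real_abs_continuousM => //.
  exact: real_abs_continuous_expR_int_sub.
apply: ae_lebesgueS P => t tP /tP[de deta ut]; exists (u t) => //.
apply: (@is_derive_eq _ _ _ _ _ _ _ _
  (is_deriveD de (is_deriveM (is_derive_expR_int_sub h c t) deta))).
rewrite expR_expR_int /GRing.scale /=; ring.
Qed.

Lemma usubmx_z_rate (R : realType) (n : nat) (h : R) (z w : 'cV[R]_(n + n)) (u : 'cV[R]_n) :
  usubmx (A_f2 n h *m z + B_f2 R n *m w + col_mx u 0) = dsubmx z + (usubmx w + u).
Proof.
rewrite -{1}[z]vsubmxK -{1}[w]vsubmxK /A_f2 /B_f2 !mul_block_col !add_col_mx col_mxKu.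
by rewrite !mul0mx !mul1mx add0r addr0 addrA.
Qed.

Lemma dsubmx_z_rate (R : realType) (n : nat) (h : R) (z w : 'cV[R]_(n + n)) (u : 'cV[R]_n) :
  dsubmx (A_f2 n h *m z + B_f2 R n *m w + col_mx u 0) = h *: dsubmx z.
Proof.
rewrite -{1}[z]vsubmxK -{1}[w]vsubmxK /A_f2 /B_f2 !mul_block_col !add_col_mx col_mxKd.
by rewrite !mul0mx mul_scalar_mx add0r !addr0.
Qed.

(* The value that [z2] takes at the next jump if [w2] and the input vanish until then. *)
Definition predict (R : realType) (n : nat) (h tau : R) (z : 'cV[R]_(n + n)) : 'cV[R]_(n + n) :=
  (1%:M + expR_int h tau *: A_f2 n h) *m z.

Lemma predictE (R : realType) (n : nat) (h tau : R) (z : 'cV[R]_(n + n)) :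
  predict h tau z = col_mx (usubmx z + expR_int h tau *: dsubmx z) (expR (h * tau) *: dsubmx z).
Proof.
rewrite /predict mulmxDl mul1mx -scalemxAl -{1 2}[z]vsubmxK /A_f2 mul_block_col.
rewrite !mul0mx mul1mx mul_scalar_mx !add0r scale_col_mx add_col_mx; congr col_mx.
by rewrite expR_expR_int scalerDl scale1r scalerA [h * _]mulrC.
Qed.

Lemma predict0 (R : realType) (n : nat) (h : R) (z : 'cV[R]_(n + n)) : predict h 0 z = z.
Proof. by rewrite /predict expR_int0 scale0r addr0 mul1mx. Qed.

(** * Evolution of the state components over one flow interval *)

Section Flow.
Context (R : realType) (n : nat) (T1 T2 mu h gamma : R) (T : 'M[R]_(1 + n))
  (lam : 'rV[R]_n) (sigma_star : R).
Let H := H_msigma T1 T2 mu h gamma T lam sigma_star.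

(** The [z1] equation is written with [A_f2 1 h] and [B_f2 R 1], convertible to [A_f1 h] and
    [B_f1 R], so that the lemmas on [z] rates serve both components. *)
Lemma state_derive (t : R) (f : R -> 'cV[R]_(state_dim n)) (m : 'cV[R]_(1 + n)) :
  is_derive t (1 : R) f (flow_map H (f t) m) ->
  [/\ coord_derive t (fun s => st_z1 (f s))
        (A_f2 1 h *m st_z1 (f t) + B_f2 R 1 *m st_w1 (f t) + col_mx (usubmx m) 0),
      coord_derive t (fun s => st_z2 (f s))
        (A_f2 n h *m st_z2 (f t) + B_f2 R n *m st_w2 (f t) + col_mx (dsubmx m) 0),
      coord_derive t (fun s => st_w1 (f s)) (A_f3 mu *m st_w1 (f t)),
      coord_derive t (fun s => st_w2 (f s)) (A_f4 n mu *m st_w2 (f t)) &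
      is_derive t (1 : R) (fun s => st_tau (f s)) (- 1)].
Proof.
move=> df; have D0 : coord_derive t f (flow_map H (f t) m) by move=> i; exact: is_derive_coord.
have D1 := coord_derive_dsubmx D0; have D2 := coord_derive_dsubmx D1.
have D3 := coord_derive_dsubmx D2; have D4 := coord_derive_dsubmx D3.
have := coord_derive_usubmx D0; have := coord_derive_usubmx D1.
have := coord_derive_usubmx D2; have := coord_derive_usubmx D3.
have := D4 0; rewrite /= /mk_state !(col_mxKd, col_mxKu) !mxE eqxx mulr1n => ? ? ? ? ?.
by split.
Qed.

Lemma state_abs_continuous (a b : R) (f : R -> 'cV[R]_(state_dim n)) :
  abs_continuous a b f ->
  [/\ coord_abs_continuous a b (fun s => st_z1 (f s)),
      coord_abs_continuous a b (fun s => st_z2 (f s)),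
      coord_abs_continuous a b (fun s => st_w1 (f s)),
      coord_abs_continuous a b (fun s => st_w2 (f s)) &
      real_abs_continuous a b (fun s => st_tau (f s))].
Proof.
move=> ac; have D0 : coord_abs_continuous a b f by move=> i; exact: real_abs_continuous_coord.
have D1 := coord_abs_continuous_dsubmx D0; have D2 := coord_abs_continuous_dsubmx D1.
have D3 := coord_abs_continuous_dsubmx D2; have D4 := coord_abs_continuous_dsubmx D3.
have := coord_abs_continuous_usubmx D0; have := coord_abs_continuous_usubmx D1.
have := coord_abs_continuous_usubmx D2; have := coord_abs_continuous_usubmx D3.
have := D4 0 => ? ? ? ? ?.
by split.
Qed.

Context (a b : R) (f : R -> 'cV[R]_(state_dim n)) (m : R -> 'cV[R]_(1 + n)).
Hypotheses (ab : a <= b) (fP : flows_on H a b f m).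

Lemma tau_flow : st_tau (f b) = st_tau (f a) - (b - a).
Proof.
have [ac _ fd] := fP; have [_ _ _ _ act] := state_abs_continuous ac.
have := @ae_derive0_cst R (fun s => st_tau (f s) + s) a b ab.
have H1 : real_abs_continuous a b (fun s => st_tau (f s) + s).
  by apply: real_abs_continuousD => //; exact: real_abs_continuous_id.
move=> /(_ H1) => H2; suff : st_tau (f b) + b = st_tau (f a) + a by lra.
apply: H2; apply: ae_lebesgueS fd => t tP /tP/state_derive[_ _ _ _ dt].
apply: (@is_derive_eq _ _ _ _ _ _ _ _ (is_deriveD dt (is_derive_id _ _))).
by rewrite addNr.
Qed.

Lemma w1_flow (P : 'M[R]_(1 + 1)) (k : R) :
  (forall x, qform (P *m A_f3 mu + (A_f3 mu)^T *m P) x <= - k * qform P x) ->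
  expR (k * b) * qform P (st_w1 (f b)) <= expR (k * a) * qform P (st_w1 (f a)).
Proof.
have [ac _ fd] := fP; have [_ _ acw _ _] := state_abs_continuous ac.
move=> lyap; apply: (lyapunov_flow lyap ab acw).
by apply: ae_lebesgueS fd => t tP /tP/state_derive[].
Qed.

Lemma w2_flow (P : 'M[R]_(n + n)) (k : R) :
  (forall x, qform (P *m A_f4 n mu + (A_f4 n mu)^T *m P) x <= - k * qform P x) ->
  expR (k * b) * qform P (st_w2 (f b)) <= expR (k * a) * qform P (st_w2 (f a)).
Proof.
have [ac _ fd] := fP; have [_ _ _ acw _] := state_abs_continuous ac.
move=> lyap; apply: (lyapunov_flow lyap ab acw).
by apply: ae_lebesgueS fd => t tP /tP/state_derive[].
Qed.

Lemma eta1_flow : dsubmx (st_z1 (f b)) = expR (h * (b - a)) *: dsubmx (st_z1 (f a)).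
Proof.
have [ac _ fd] := fP; have [acz _ _ _ _] := state_abs_continuous ac.
have acd := coord_abs_continuous_dsubmx acz.
apply/matrixP => i j; rewrite !ord1 [RHS]mxE.
apply: (@eta_flow R h a b (fun s => dsubmx (st_z1 (f s)) 0 0) ab) => //.
apply: ae_lebesgueS fd => t tP /tP/state_derive[/coord_derive_dsubmx dz _ _ _ _].
by have := dz 0; rewrite dsubmx_z_rate [X in is_derive _ _ _ X]mxE.
Qed.

Lemma predict_flow (B : R) : 0 <= B ->
  (forall t, a < t < b -> `|usubmx (st_w2 (f t)) + dsubmx (m t)| <= B) ->
  `|predict h (st_tau (f b)) (st_z2 (f b)) - predict h (st_tau (f a)) (st_z2 (f a))|
     <= B * (b - a).
Proof.
move=> B0 uB; have [ac _ fd] := fP; have [_ acz _ _ _] := state_abs_continuous ac.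
have acd := coord_abs_continuous_dsubmx acz; have acu := coord_abs_continuous_usubmx acz.
have dz : {ae lebesgue_measure, forall t : R, a < t < b ->
    forall i, [/\ is_derive t (1 : R) (fun s => usubmx (st_z2 (f s)) i 0)
                    (dsubmx (st_z2 (f t)) i 0 + (usubmx (st_w2 (f t)) + dsubmx (m t)) i 0),
                  is_derive t (1 : R) (fun s => dsubmx (st_z2 (f s)) i 0)
                    (h * dsubmx (st_z2 (f t)) i 0) &
                  `|(usubmx (st_w2 (f t)) + dsubmx (m t)) i 0| <= B]}.
  apply: ae_lebesgueS fd => t tP tab i; have /state_derive[_ dz _ _ _] := tP tab.
  split.
  - by have := coord_derive_usubmx dz i; rewrite usubmx_z_rate [X in is_derive _ _ _ X]mxE.
  - by have := coord_derive_dsubmx dz i; rewrite dsubmx_z_rate [X in is_derive _ _ _ X]mxE.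
  - by apply: le_trans (uB t tab); exact: coord_le_norm.
have c0 : 0 <= B * (b - a) by rewrite mulr_ge0 // subr_ge0.
have Eeta : dsubmx (st_z2 (f b)) = expR (h * (b - a)) *: dsubmx (st_z2 (f a)).
  apply/matrixP => k j; rewrite !ord1 [RHS]mxE.
  apply: (@eta_flow R h a b (fun s => dsubmx (st_z2 (f s)) k 0) ab) => //.
  by apply: ae_lebesgueS dz => t tP /tP /(_ k)[].
(* The predicted [eta] is constant along the flow: its growth is offset by the decrease of the
   timer. Only the upper block of the difference remains. *)
have Etau : h * st_tau (f b) + h * (b - a) = h * st_tau (f a) by rewrite tau_flow; ring.
rewrite !predictE opp_col_mx add_col_mx Eeta [X in col_mx _ (X - _)]scalerA -expRD Etau subrr -Eeta.
apply: norm_le_coord => // i j.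
rewrite ord1 mxE; case: (fintype.split i) => k; last by rewrite mxE normr0.
have := @predicted_flow R h (st_tau (f a) + a) a b B (fun s => usubmx (st_z2 (f s)) k 0)
  (fun s => dsubmx (st_z2 (f s)) k 0) (fun t => (usubmx (st_w2 (f t)) + dsubmx (m t)) k 0)
  ab B0 (acu k) (acd k).
have -> : st_tau (f a) + a - b = st_tau (f b) by rewrite tau_flow; ring.
have -> : st_tau (f a) + a - a = st_tau (f a) by ring.
rewrite !mxE; apply.
by apply: ae_lebesgueS dz => t tP /tP /(_ k); rewrite !mxE.
Qed.

End Flow.

(** * Jumps and trajectories *)

(** Turns the hybrid arc up to [(T, J)] into a finite sequence of jump times, so that later
    arguments are inductions on [j]. *)
Lemma solution_intervals (R : realType) (p q : nat) (H : hybrid_system R p q) E phi m T J :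
  solution_pair H E phi m -> E (T, J) ->
  exists t : nat -> R,
    [/\ t 0%N = 0,
        t J <= T <= t J.+1,
        forall j, (j <= J)%N -> t j <= t j.+1 /\ forall s, t j <= s <= t j.+1 -> E (s, j),
        forall j, (j <= J)%N -> flows_on H (t j) (t j.+1) (phi^~ j) (m^~ j) &
        forall j, (j < J)%N -> jump_map H (phi (t j.+1) j) (phi (t j.+1) j.+1)
                               /\ jump_set H (phi (t j.+1) j)].
Proof.
move=> [[E0 Edom] _ _ flowP jumpP] ETJ.
have [t [t0 tS Et]] := Edom T J ETJ; exists t.
have mem j s : (j <= J)%N -> t j <= s <= t j.+1 -> E (s, j).
  move=> jJ sj; have : [set p | (p.2 <= J)%N /\ t p.2 <= p.1 <= t p.2.+1] (s, j) by [].
  by rewrite -Et => -[].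
split => //.
- have : (E `&` [set p | 0 <= p.1 <= T /\ (p.2 <= J)%N]) (T, J).
    by split => //; split => //=; rewrite lexx andbT (E0 _ ETJ).
  by rewrite Et => -[].
- by move=> j jJ; split; [exact: tS | move=> s; exact: mem].
- move=> j jJ; have /= [acf fs fd] := flowP j.
  have int s : t j < s < t j.+1 -> (flow_interval E j)° s.
    move=> sj; have : nbhs s `]t j, t j.+1[%classic.
      by apply: open_nbhs_nbhs; split; [exact: interval_open | rewrite /= in_itv].
    apply: filterS => x /=; rewrite in_itv /= => /andP[jx xj].
    by apply: mem => //; rewrite !ltW.
  split.
  + by apply: acf; [exact: tS | move=> s /=; rewrite in_itv /= => sj; exact: mem].
  + by move=> s /int; exact: fs.
  + by apply: ae_lebesgueS fd => s sP /int; exact: sP.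
- move=> j jJ; have jJ' := ltnW jJ.
  have Ej : E (t j.+1, j) by apply: mem => //; rewrite lexx tS.
  have Ej1 : E (t j.+1, j.+1) by apply: mem => //; rewrite lexx tS.
  by have [] := jumpP _ _ Ej Ej1.
Qed.

Lemma expR_int_bounded (R : realType) (h T2 nu : R) :
  0 <= nu <= T2 -> `|expR_int h nu| <= expR_int h T2.
Proof.
move=> /andP[nu0 nuT]; have := le_expR_int h nu0; rewrite expR_int0 => p0.
by rewrite ger0_norm // le_expR_int.
Qed.

Lemma expR_bounded (R : realType) (h T2 nu : R) : 0 <= nu <= T2 ->
  expR (h * nu) <= expR (`|h| * T2).
Proof.
move=> /andP[nu0 nuT]; rewrite ler_expR; apply: le_trans (_ : `|h| * nu <= _).
  by rewrite ler_wpM2r // ler_norm.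
by rewrite ler_wpM2l.
Qed.

(** Prediction is inverted by recovering [eta] with the factor [expR (- h * tau)] and then [e] by
    subtraction; all coefficients are bounded on [[0, T2]]. *)
Lemma norm_predict (R : realType) (n : nat) (h T2 : R) : 0 <= T2 ->
  exists2 C, 0 < C & forall tau (z : 'cV[R]_(n + n)), 0 <= tau <= T2 ->
    `|z| <= C * `|predict h tau z| /\ `|predict h tau z| <= C * `|z|.
Proof.
move=> T20; pose F := expR_int h T2; pose G := expR (`|h| * T2).
have F0 : 0 <= F by rewrite -(expR_int0 h); exact: le_expR_int.
have G0 : 0 < G by exact: expR_gt0.
exists (1 + F + G + F * G); first by have := mulr_ge0 F0 (ltW G0); lra.
move=> tau z tauT; have pF := expR_int_bounded h tauT; have eG := expR_bounded h tauT.
have eNG := expR_bounded (- h) tauT; rewrite normrN -/G in eNG.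
have FG := mulr_ge0 F0 (ltW G0).
split; last first.
  rewrite predictE; apply: le_trans (norm_col_mx _ _) _.
  have := ler_normD (usubmx z) (expR_int h tau *: dsubmx z); rewrite !normrZ.
  rewrite (ger0_norm (expR_ge0 _)).
  have := norm_usubmx z; have := norm_dsubmx z.
  have : `|expR_int h tau| * `|dsubmx z| <= F * `|z| by apply: ler_pM => //; exact: norm_dsubmx.
  have : expR (h * tau) * `|dsubmx z| <= G * `|z|.
    by apply: ler_pM => //; exact: norm_dsubmx.
  have := mulr_ge0 FG (normr_ge0 z); lra.
pose x := predict h tau z.
have deq : dsubmx z = expR (- h * tau) *: dsubmx x.
  by rewrite /x predictE col_mxKd scalerA -expRD -mulrDl addNr mul0r expR0 scale1r.
have ueq : usubmx z = usubmx x - expR_int h tau *: dsubmx z.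
  by rewrite /x predictE col_mxKu addrK.
have nd : `|dsubmx z| <= G * `|x|.
  rewrite deq normrZ (ger0_norm (expR_ge0 _)).
  by apply: ler_pM => //; exact: norm_dsubmx.
have nu : `|usubmx z| <= `|x| + F * (G * `|x|).
  rewrite ueq; apply: le_trans (ler_normB _ _) _; rewrite normrZ.
  apply: lerD; first exact: norm_usubmx.
  by apply: ler_pM.
rewrite -/x -[z in `|z|]vsubmxK; apply: le_trans (norm_col_mx _ _) _.
have := normr_ge0 x; have := mulr_ge0 F0 (normr_ge0 x); lra.
Qed.

Lemma A_f2_sqr (R : realType) (n : nat) (h : R) : A_f2 n h *m A_f2 n h = h *: A_f2 n h.
Proof.
rewrite /A_f2 mulmx_block !mulmx0 !mul0mx !mul1mx !add0r scale_block_mx !scaler0.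
by rewrite scalemx1 mul_scalar_mx.
Qed.

Lemma jump_contraction (R : realType) (n : nat) (h gamma T1 T2 : R) (lam : 'rV[R]_n)
    (P1 : 'M[R]_(n + n)) :
  T1 <= T2 -> sym_posdef P1 ->
  (forall nu, T1 <= nu <= T2 -> negdef (jump_decrease h gamma lam P1 nu)) ->
  exists2 r, 0 <= r < 1 & forall nu z, T1 <= nu <= T2 ->
    pnorm P1 (predict h nu (A_g2 gamma lam *m z)) <= r * pnorm P1 z.
Proof.
move=> T12 Pp neg; pose M nu := (1%:M + expR_int h nu *: A_f2 n h) *m A_g2 gamma lam.
have contr nu : T1 <= nu <= T2 ->
    exists2 r, 0 <= r < 1 & forall z, pnorm P1 (M nu *m z) <= r * pnorm P1 z.
  move=> nuT; apply: uniform_contraction => // x x0.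
  have := neg nu nuT x x0; rewrite /jump_decrease qformB subr_lt0 => lt.
  apply: le_lt_trans lt.
  rewrite qform_mulmx /expP (expm_scaled _ (A_f2_sqr n h)).
  (* The closed formula applied to the transpose shows that the left exponential in [expP] is the
     transpose of the right one. *)
  have AT : (A_f2 n h)^T *m (A_f2 n h)^T = h *: (A_f2 n h)^T.
    by rewrite -trmx_mul A_f2_sqr; apply/matrixP => i j; rewrite !mxE.
  rewrite (expm_scaled _ AT) le_eqVlt; apply/orP; left; apply/eqP; congr qform.
  rewrite /M trmx_mul !mulmxA; congr (_ *m _ *m _ *m _ *m _).
  by apply/matrixP => i j; rewrite !mxE eq_sym.
(* The contraction factors at the endpoints [T1] and [T2] suffice: every other [M nu] is a convex
   combination of [M T1] and [M T2]. *)
have [|r1 /andP[r10 r11] r1P] := contr T1; first by rewrite lexx.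
have [|r2 /andP[r20 r21] r2P] := contr T2; first by rewrite lexx andbT.
exists (Num.max r1 r2); first by rewrite le_max r10 gt_max r11.
move=> nu z nuT; have /andP[T1nu nuT2] := nuT.
have f1 := le_expR_int h T1nu; have f2 := le_expR_int h nuT2.
have [c c01 cE] : exists2 c, 0 <= c <= 1 &
    expR_int h nu = (1 - c) * expR_int h T1 + c * expR_int h T2.
  have [e|ne] := eqVneq (expR_int h T1) (expR_int h T2).
    by exists 0; [rewrite lexx ler01 | apply/eqP; rewrite eq_le -{2}e; apply/andP; split; lra].
  have d0 : 0 < expR_int h T2 - expR_int h T1 by rewrite subr_gt0 lt_neqAle ne; exact: le_trans f2.
  exists ((expR_int h nu - expR_int h T1) / (expR_int h T2 - expR_int h T1)).
    apply/andP; split; first by apply: divr_ge0; [rewrite subr_ge0 | exact: ltW].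
    by rewrite ler_pdivrMr //; lra.
  by field; rewrite gt_eqF.
have -> : predict h nu (A_g2 gamma lam *m z) = (1 - c) *: (M T1 *m z) + c *: (M T2 *m z).
  rewrite /predict /M -!mulmxA; set y := A_g2 gamma lam *m z.
  rewrite !mulmxDl !mul1mx -!scalemxAl cE; set x := A_f2 n h *m y.
  rewrite !scalerDr !scalerA addrACA -scalerDl subrK scale1r; congr (_ + _).
  by rewrite -scalerDl.
apply: le_trans (pnormD _ _ Pp) _; rewrite !pnormZ.
have /andP[c0 c1] := c01; rewrite (ger0_norm c0) (ger0_norm (_ : 0 <= 1 - c)) ?subr_ge0 //.
have z0 := pnorm_ge0 P1 z.
have m1 : pnorm P1 (M T1 *m z) <= Num.max r1 r2 * pnorm P1 z.
  by apply: le_trans (r1P z) _; rewrite ler_wpM2r // le_max lexx.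
have m2 : pnorm P1 (M T2 *m z) <= Num.max r1 r2 * pnorm P1 z.
  by apply: le_trans (r2P z) _; rewrite ler_wpM2r // le_max lexx orbT.
nra.
Qed.

(** Converts decay in time into decay per jump. The rate is halved by the square root, and the
    factor [expR (k / 2 * T1)] in the constant pays for a possibly short first interval. *)
Lemma decay_bound (R : realType) (p : nat) (P : 'M[R]_p) (k T1 : R) :
  sym_posdef P -> 0 < k ->
  exists2 C, 0 < C & forall (x y : 'cV[R]_p) (s : R) (j : nat), j%:R * T1 <= s + T1 ->
    expR (k * s) * qform P y <= qform P x -> `|y| <= C * expR (- (k / 2 * T1)) ^+ j * `|x|.
Proof.
move=> Pp k0; have [c [D [c0 D0 cD]]] := pnorm_equiv Pp.
exists (c^-1 * D * expR (k / 2 * T1)); first by rewrite !mulr_gt0 ?invr_gt0 ?expR_gt0.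
move=> x y s j sj yx.
have h1 : pnorm P y <= expR (- (k / 2 * s)) * pnorm P x.
  have ke : expR (k * s) = expR (k / 2 * s) ^+ 2.
    by rewrite expr2 -expRD -mulrDl -splitr.
  rewrite expRN mulrC ler_pdivlMr ?expR_gt0 //.
  rewrite /pnorm -[leLHS](mulrC) -[X in X * _](ger0_norm (expR_ge0 _)) -sqrtr_sqr.
  by rewrite -sqrtrM ?sqr_ge0 // -ke ler_wsqrtr.
have /andP[cy _] := cD y; have /andP[_ xD] := cD x.
have h2 : expR (- (k / 2 * s)) <= expR (k / 2 * T1) * expR (- (k / 2 * T1)) ^+ j.
  rewrite -expRM_natl -expRD ler_expR.
  have : k / 2 * (j%:R * T1) <= k / 2 * (s + T1) by rewrite ler_pM2l // divr_gt0.
  lra.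
have h3 : c * `|y| <= expR (k / 2 * T1) * expR (- (k / 2 * T1)) ^+ j * (D * `|x|).
  apply: le_trans cy _; apply: le_trans h1 _.
  by apply: ler_pM => //; exact: pnorm_ge0.
have := h3; rewrite -(@ler_pM2l _ c^-1) ?invr_gt0 // mulKf ?gt_eqF // => h4.
apply: le_trans h4 _; rewrite le_eqVlt; apply/orP; left; apply/eqP; ring.
Qed.

(** The flow set is imposed only strictly inside the interval; a timer negative at [b] would, having
    slope -1, already be negative shortly before. *)
Lemma tau_range (R : realType) (n : nat) (T1 T2 mu h gamma : R) (T : 'M[R]_(1 + n))
    (lam : 'rV[R]_n) (sigma_star a b : R) f m :
  a <= b -> flows_on (H_msigma T1 T2 mu h gamma T lam sigma_star) a b f m ->
  0 <= st_tau (f a) <= T2 -> 0 <= st_tau (f b) <= T2.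
Proof.
move=> ab fP /andP[a0 aT]; have tb := tau_flow ab fP.
apply/andP; split; last by lra.
rewrite leNgt; apply/negP => neg.
have {ab} ab : a < b by rewrite lt_neqAle ab andbT; apply/eqP => e; move: neg; rewrite -e; lra.
(* An interior time at which the timer is at most [st_tau (f b) / 2 < 0]. *)
pose s := Num.max ((a + b) / 2) (b + st_tau (f b) / 2).
have s1 : (a + b) / 2 <= s by rewrite le_max lexx.
have s2 : b + st_tau (f b) / 2 <= s by rewrite le_max lexx orbT.
have s3 : s < b by rewrite gt_max; apply/andP; split; lra.
have as_ : a <= s by lra.
have [_ fs _] := fP; have /andP[ts _] : X_eps T2 (f s) by apply: fs; lra.
have := tau_flow as_ (flows_onW (ltW s3) fP); lra.
Qed.

(** * Estimates along a whole trajectory, by induction on the jumps *)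

Section Trajectory.
Context (R : realType) (n : nat) (T1 T2 mu h gamma : R) (T : 'M[R]_(1 + n))
  (lam : 'rV[R]_n) (sigma_star : R).
Let H := H_msigma T1 T2 mu h gamma T lam sigma_star.
Context (phi : R -> nat -> 'cV[R]_(state_dim n)) (m : R -> nat -> 'cV[R]_(1 + n))
  (J : nat) (t : nat -> R).
Context (T1_gt0 : 0 < T1) (T12 : T1 <= T2) (t0 : t 0%N = 0)
  (tS : forall j, (j <= J)%N -> t j <= t j.+1)
  (flowP : forall j, (j <= J)%N -> flows_on H (t j) (t j.+1) (phi^~ j) (m^~ j))
  (jumpP : forall j, (j < J)%N -> jump_map H (phi (t j.+1) j) (phi (t j.+1) j.+1)
                                  /\ jump_set H (phi (t j.+1) j))
  (tau0 : 0 <= st_tau (phi 0 0%N) <= T2).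

Lemma partial_flow j s : (j <= J)%N -> s <= t j.+1 -> flows_on H (t j) s (phi^~ j) (m^~ j).
Proof. by move=> jJ st; apply: flows_onW st _; exact: flowP. Qed.

Lemma state_jump j : (j < J)%N -> exists2 nu, T1 <= nu <= T2 &
  [/\ st_tau (phi (t j.+1) j) = 0,
      st_tau (phi (t j.+1) j.+1) = nu,
      dsubmx (st_z1 (phi (t j.+1) j.+1)) = 0,
      st_z2 (phi (t j.+1) j.+1) = A_g2 gamma lam *m st_z2 (phi (t j.+1) j) &
      st_w1 (phi (t j.+1) j.+1) = st_w1 (phi (t j.+1) j) /\
      st_w2 (phi (t j.+1) j.+1) = st_w2 (phi (t j.+1) j)].
Proof.
move=> /jumpP[[nu nuT <-] [_ tau_0]]; exists nu; first by move: nuT; rewrite /= in_itv.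
split => //.
- by rewrite /st_tau /mk_state !col_mxKd !mxE eqxx mulr1n.
- rewrite [st_z1 (mk_state _ _ _ _ _)]col_mxKu -[st_z1 _]vsubmxK /A_g1 mul_block_col.
  by rewrite col_mxKd !mul0mx addr0.
- by rewrite /st_z2 /mk_state !(col_mxKd, col_mxKu).
- by rewrite /st_w1 /st_w2 /mk_state !(col_mxKd, col_mxKu).
Qed.

(** An interval ended by a jump is as long as the timer value at its start, which is at least [T1]
    after a reset but arbitrary in [[0, T2]] initially; hence the [T1] added in the lower bound. *)
Lemma jump_times j : (j <= J)%N ->
  [/\ 0 <= st_tau (phi (t j) j) <= T2, (0 < j)%N -> T1 <= st_tau (phi (t j) j),
      j%:R * T1 <= t j + T1 & t j <= j%:R * T2].
Proof.
elim: j => [|j IH] jJ; first by rewrite t0 !mul0r add0r; split => //; exact: ltW.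
have [tauj tauj1 jT1 jT2] := IH (ltnW jJ).
have [nu /andP[nu1 nu2] [tau_0 -> _ _ _]] := state_jump jJ.
have := tau_flow (tS (ltnW jJ)) (flowP (ltnW jJ)); rewrite tau_0 => tE.
have /andP[tauj0 taujT] := tauj.
rewrite -natr1; split => //.
  by rewrite nu2 (le_trans (ltW T1_gt0) nu1).
  case: j {IH jT2 tauj tauj0 taujT tau_0 nu nu1 nu2} jJ jT1 tauj1 tE => [|j] jJ jT1 tauj1 tE.
    by have := tS (ltnW jJ); rewrite t0 mulr0n; move: (t 1%N) => u u0; move: T1_gt0; lra.
  by have := tauj1 isT; lra.
lra.
Qed.

Lemma during j s : (j <= J)%N -> t j <= s <= t j.+1 ->
  [/\ 0 <= st_tau (phi s j) <= T2, 0 <= s - t j <= T2, j%:R * T1 <= s + T1 &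
      s <= (j%:R + 1) * T2].
Proof.
move=> jJ /andP[js sj]; have [tauj _ jT1 jT2] := jump_times jJ.
have fl := partial_flow jJ sj; have tE := tau_flow js fl.
have taus := tau_range js fl tauj.
by split => //; move: tauj taus => /andP[? ?] /andP[? ?]; lra.
Qed.

Lemma w1_decay (P : 'M[R]_(1 + 1)) (k : R) j s :
  (forall x, qform (P *m A_f3 mu + (A_f3 mu)^T *m P) x <= - k * qform P x) ->
  (j <= J)%N -> t j <= s <= t j.+1 ->
  expR (k * s) * qform P (st_w1 (phi s j)) <= qform P (st_w1 (phi 0 0%N)).
Proof.
move=> lyap; elim: j s => [|j IH] s jJ /andP[js sj];
  apply: le_trans (w1_flow js (partial_flow jJ sj) lyap) _.
  by rewrite t0 mulr0 expR0 mul1r.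
have [nu _ [_ _ _ _ [-> _]]] := state_jump jJ.
by apply: IH; [exact: ltnW | rewrite lexx andbT tS // ltnW].
Qed.

Lemma w2_decay (P : 'M[R]_(n + n)) (k : R) j s :
  (forall x, qform (P *m A_f4 n mu + (A_f4 n mu)^T *m P) x <= - k * qform P x) ->
  (j <= J)%N -> t j <= s <= t j.+1 ->
  expR (k * s) * qform P (st_w2 (phi s j)) <= qform P (st_w2 (phi 0 0%N)).
Proof.
move=> lyap; elim: j s => [|j IH] s jJ /andP[js sj];
  apply: le_trans (w2_flow js (partial_flow jJ sj) lyap) _.
  by rewrite t0 mulr0 expR0 mul1r.
have [nu _ [_ _ _ _ [_ ->]]] := state_jump jJ.
by apply: IH; [exact: ltnW | rewrite lexx andbT tS // ltnW].
Qed.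

(** After a reset the rate error stays 0, so only [j = 0] matters, where [r ^+ 0 = 1]; the power of
    [r] matches the other estimates. *)
Lemma eta1_bound (r : R) j s : 0 <= r -> (j <= J)%N -> t j <= s <= t j.+1 ->
  `|dsubmx (st_z1 (phi s j))| <= expR (`|h| * T2) * r ^+ j * `|dsubmx (st_z1 (phi 0 0%N))|.
Proof.
move=> r0 jJ sj; have [_ sT _ _] := during jJ sj; have /andP[js sj'] := sj.
rewrite (eta1_flow js (partial_flow jJ sj')) normrZ (ger0_norm (expR_ge0 _)) -mulrA.
apply: ler_pM; rewrite ?expR_ge0 ?expR_bounded //.
case: j jJ {sj js sj' sT} => [|j] jJ; first by rewrite t0 expr0 mul1r.
by have [nu _ [_ _ -> _ _]] := state_jump jJ; rewrite normr0 mulr_ge0 // exprn_ge0.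
Qed.

(* [K = rho C / (r - rho)] and [L = rho C / (1 - rho)] solve [rho (K + C) = r K] and
   [rho (L + C) = L]: the predicted state at the beginning of the j-th interval is perturbed by
   at most [C (r ^ j W + M)] during the flow and contracted by [rho] at the jump. *)
Lemma predict_bound (P1 : 'M[R]_(n + n)) (rho r C D M W : R) j s :
  sym_posdef P1 -> 0 <= rho -> rho < r -> r < 1 -> 0 <= D -> D * T2 <= C -> 0 <= M -> 0 <= W ->
  (forall z, pnorm P1 z <= D * `|z|) ->
  (forall nu z, T1 <= nu <= T2 ->
     pnorm P1 (predict h nu (A_g2 gamma lam *m z)) <= rho * pnorm P1 z) ->
  (forall j s, (j <= J)%N -> t j <= s <= t j.+1 -> `|st_w2 (phi s j)| <= r ^+ j * W) ->
  (forall j s, (j <= J)%N -> t j <= s <= t j.+1 -> `|dsubmx (m s j)| <= M) ->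
  (j <= J)%N -> t j <= s <= t j.+1 ->
  pnorm P1 (predict h (st_tau (phi s j)) (st_z2 (phi s j))) <=
    r ^+ j * (pnorm P1 (predict h (st_tau (phi 0 0%N)) (st_z2 (phi 0 0%N)))
              + (rho * C / (r - rho) + C) * W) + (rho * C / (1 - rho) + C) * M.
Proof.
move=> Pp rho0 rhor r1 D0 DC M0 W0 PD contr wW mM jJ sj.
have C0 : 0 <= C by apply: le_trans DC; rewrite mulr_ge0 // (le_trans (ltW T1_gt0)).
set K := rho * C / (r - rho); set L := rho * C / (1 - rho).
have KE : rho * C + rho * K = r * K by rewrite /K; field; rewrite gt_eqF //; lra.
have LE : rho * C + rho * L = L by rewrite /L; field; rewrite gt_eqF //; lra.
have K0 : 0 <= K by rewrite /K divr_ge0 ?mulr_ge0 //; lra.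
have L0 : 0 <= L by rewrite /L divr_ge0 ?mulr_ge0 //; lra.
pose x s j := predict h (st_tau (phi s j)) (st_z2 (phi s j)).
have flow i u : (i <= J)%N -> t i <= u <= t i.+1 ->
    pnorm P1 (x u i) <= pnorm P1 (x (t i) i) + C * (r ^+ i * W + M).
  move=> iJ ui; have [_ /andP[ui0 uiT] _ _] := during iJ ui; have /andP[iu ui'] := ui.
  have B0 : 0 <= r ^+ i * W + M by rewrite addr_ge0 ?mulr_ge0 ?exprn_ge0 //; lra.
  rewrite -[x u i](subrK (x (t i) i)) addrC; apply: le_trans (pnormD _ _ Pp) _.
  rewrite lerD2l; apply: le_trans (PD _) _.
  apply: (@le_trans _ _ (D * T2 * (r ^+ i * W + M))); last exact: ler_wpM2r.
  rewrite -mulrA ler_wpM2l //.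
  rewrite [X in _ <= X]mulrC; apply: (@le_trans _ _ ((r ^+ i * W + M) * (u - t i))).
    apply: (predict_flow iu (partial_flow iJ ui') B0) => v /andP[iv vu].
    have vi : t i <= v <= t i.+1 by rewrite (ltW iv) (le_trans (ltW vu)).
    apply: le_trans (ler_normD _ _) _; apply: lerD; last exact: mM.
    by apply: le_trans (norm_usubmx _) _; exact: wW.
  by rewrite ler_wpM2l.
have start i : (i <= J)%N ->
    pnorm P1 (x (t i) i) <= r ^+ i * (pnorm P1 (x 0 0%N) + K * W) + L * M.
  elim: i => [|i IH] iJ.
    by rewrite t0 expr0 mul1r -addrA lerDl addr_ge0 // mulr_ge0.
  have [nu nuT [tau_0 tau_nu _ zE _]] := state_jump iJ.
  have -> : x (t i.+1) i.+1 = predict h nu (A_g2 gamma lam *m st_z2 (phi (t i.+1) i)).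
    by rewrite /x tau_nu zE.
  apply: le_trans (contr _ _ nuT) _.
  (* Just before a jump the timer is 0 and the prediction is [z2] itself, so the contraction applies
     to the predicted state. *)
  have -> : st_z2 (phi (t i.+1) i) = x (t i.+1) i by rewrite /x tau_0 predict0.
  have := flow i (t i.+1) (ltnW iJ); rewrite lexx (tS (ltnW iJ)) => /(_ isT) h1.
  have h2 := IH (ltnW iJ).
  have ri : 0 <= r ^+ i by rewrite exprn_ge0 //; lra.
  apply: (@le_trans _ _ (rho * (r ^+ i * (pnorm P1 (x 0 0%N) + K * W) + L * M
                               + C * (r ^+ i * W + M)))).
    by rewrite ler_wpM2l //; lra.
  have -> : rho * (r ^+ i * (pnorm P1 (x 0 0%N) + K * W) + L * M + C * (r ^+ i * W + M)) =
    r ^+ i * (rho * pnorm P1 (x 0 0%N)) + r ^+ i * ((rho * C + rho * K) * W)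
    + (rho * C + rho * L) * M by ring.
  rewrite KE LE exprSr; set Y := pnorm P1 (x 0 0%N).
  have : r ^+ i * (rho * Y) <= r ^+ i * (r * Y).
    by apply: ler_wpM2l => //; apply: ler_wpM2r; [exact: pnorm_ge0 | exact: ltW].
  lra.
have h1 := flow j s jJ sj; have h2 := start j jJ.
apply: le_trans h1 _; apply: le_trans (lerD h2 (lexx _)) _.
by rewrite le_eqVlt; apply/orP; left; apply/eqP; rewrite /x; ring.
Qed.

End Trajectory.

(** * Comparison functions and distance to the attractor *)

Lemma dist_to_ge0 (R : realType) (p : nat) (S : set 'cV[R]_p) x : 0 <= dist_to S x.
Proof.
have [[y Sy]|S0] := pselect (S !=set0).
  apply: lb_le_inf; first by exists (enorm (x - y)); exists y.
  by move=> _ [z _ <-]; exact: sqrtr_ge0.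
(* The infimum of the empty set has the default value 0. *)
rewrite /dist_to (_ : S = set0) ?image_set0 ?inf0 //.
by apply/seteqP; split => // y Sy; case: S0; exists y.
Qed.

Lemma classK_linear (R : realType) (L : R) : 0 < L -> classK ( *%R L).
Proof.
move=> L0; split; first by rewrite mulr0.
  by apply: continuous_subspaceT => x; apply: cvgM; [exact: cvg_cst | exact: cvg_id].
by move=> s t _ st; rewrite ltr_pM2l.
Qed.

Lemma classKL_exp (R : realType) (B c : R) : 0 < B -> 0 < c ->
  classKL (fun s t => B * expR (- (c * t)) * s).
Proof.
move=> B0 c0; split.
- apply: continuous_subspaceT => -[x y] /=; apply: cvgM; last exact: cvg_fst.
  apply: cvgM; first exact: cvg_cst.
  apply: (@continuous_comp _ _ _ (fun p : R * R => - (c * p.2)) expR); last exact: continuous_expR.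
  by apply: cvgN; apply: cvgM; [exact: cvg_cst | exact: cvg_snd].
- by move=> t _; apply: classK_linear; rewrite mulr_gt0 ?expR_gt0.
- move=> s t u s0 _ tu; rewrite ler_wpM2r // ler_pM2l // ler_expR lerN2 ler_pM2l //.
- move=> s s0; rewrite -(mul0r s) -(mulr0 B); apply: cvgM; last exact: cvg_cst.
  apply: cvgM; first exact: cvg_cst.
  have -> : (fun t : R => expR (- (c * t))) = (expR \o -%R) \o ( *%R c).
    by apply/funext => t.
  apply: (@cvg_comp _ _ _ ( *%R c) (expR \o -%R) _ +oo).
    by apply: gt0_cvgMry.
  by apply: cvgr_expR.
Qed.

Lemma iss_of_geometric_bound (R : realType) (p q : nat) (H : hybrid_system R p q)
    (A : set 'cV[R]_p) (B L r D : R) :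
  0 < B -> 0 < L -> 0 < r -> r < 1 -> 0 < D ->
  (forall E phi m M, solution_pair H E phi m ->
     (forall t j, E (t, j) -> enorm (m t j) <= M) ->
     forall t j, E (t, j) ->
       t <= (j%:R + 1) * D /\
       dist_to A (phi t j) <= B * r ^+ j * dist_to A (phi 0 0%N) + L * M) ->
  input_to_state_stable H A.
Proof.
move=> B0 L0 r0 r1 D0 HP.
have a0 : 0 < - ln r by rewrite oppr_gt0 ln_lt0 // r0.
(* As [t + j <= (j + 1) * (D + 1)], this rate gives [c * (t + j) <= a * (j + 1)], that is [r ^+ j <=
   expR a * expR (- (c * (t + j)))]. *)
pose a := - ln r; pose c := a / (D + 1).
have D1 : 0 < D + 1 by lra.
have c0 : 0 < c by rewrite divr_gt0.
(* The factors 2 turn the sum of the two bounds into a maximum. *)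
exists (fun s t => 2 * B * expR a * expR (- (c * t)) * s), ( *%R (2 * L)); split.
- by apply: classKL_exp => //; rewrite !mulr_gt0 ?expR_gt0.
- by apply: classK_linear; rewrite mulr_gt0.
move=> E phi m sol ub t j Etj.
have [|tj] := HP E phi m (sup (input_norms E m)) sol _ t j Etj.
  move=> u i Eui; apply: sup_upper_bound; last by exists (u, i).
  by split => //; exists (enorm (m u i)); exists (u, i).
have rj : r ^+ j <= expR a * expR (- (c * (t + j%:R))).
  have -> : r = expR (- a) by rewrite opprK lnK ?posrE.
  rewrite -expRM_natl -expRD ler_expR.
  have : c * (t + j%:R) <= c * ((j%:R + 1) * (D + 1)) by rewrite ler_pM2l //; lra.
  have -> : c * ((j%:R + 1) * (D + 1)) = a * (j%:R + 1) by rewrite /c; field; rewrite gt_eqF.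
  lra.
have d0 := dist_to_ge0 A (phi 0 0%N).
have : B * r ^+ j * dist_to A (phi 0 0%N) <=
       B * (expR a * expR (- (c * (t + j%:R)))) * dist_to A (phi 0 0%N).
  by rewrite ler_wpM2r // ler_pM2l.
move: (expR (- (c * (t + j%:R)))) => ec h1 h2.
rewrite le_max; apply/orP.
have [uv|uv] := leP (B * (expR a * ec) * dist_to A (phi 0 0%N)) (L * sup (input_norms E m)).
  by right; lra.
by left; lra.
Qed.

(** Equivalent to the distance to the attractor on [X_eps]: the upper entry of [z1] and the timer
    are left out because the attractor leaves them free. *)
Definition state_size (R : realType) (n : nat) (chi : 'cV[R]_(state_dim n)) : R :=
  `|dsubmx (st_z1 chi)| + `|st_z2 chi| + `|st_w1 chi| + `|st_w2 chi|.

Lemma state_size_le_dist (R : realType) (n : nat) (T2 : R) (chi : 'cV[R]_(state_dim n)) :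
  0 <= T2 -> state_size chi <= 4 * dist_to (@A_eps R n T2) chi.
Proof.
move=> T20; set d := dist_to _ _.
(* The attractor is nonempty, so the infimum defining the distance is not a default value. *)
have A0 : @A_eps R n T2 0.
  split; first by rewrite /X_eps /= /st_tau !mxE lexx T20.
  exists 0; split; rewrite ?/st_z1 ?/st_z2 ?/st_w1 ?/st_w2 ?linear0 //.
  by apply/matrixP => i j; rewrite !mxE; case: (fintype.split i) => k; rewrite !mxE // mul0rn.
have le_d u : (forall y, @A_eps R n T2 y -> u <= `|chi - y|) -> u <= d.
  move=> uP; apply: lb_le_inf; first by exists (enorm (chi - 0)); exists 0.
  by move=> _ [y Ay <-]; apply: le_trans (uP y Ay) (norm_le_enorm _).
have h1 : `|dsubmx (st_z1 chi)| <= d.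
  apply: le_d => y [_ [e [yz1 _ _ _]]].
  have -> : dsubmx (st_z1 chi) = dsubmx (st_z1 (chi - y)).
    by rewrite [st_z1 (chi - y)]linearB linearB /= -[usubmx y]/(st_z1 y) yz1 col_mxKd subr0.
  exact: le_trans (norm_dsubmx _) (norm_usubmx _).
have h2 : `|st_z2 chi| <= d.
  apply: le_d => y [_ [e [_ yz2 _ _]]].
  have -> : st_z2 chi = st_z2 (chi - y).
    by rewrite [RHS]/st_z2 !linearB /= -[usubmx (dsubmx y)]/(st_z2 y) yz2 subr0.
  exact: le_trans (norm_usubmx _) (norm_dsubmx _).
have h3 : `|st_w1 chi| <= d.
  apply: le_d => y [_ [e [_ _ yw1 _]]].
  have -> : st_w1 chi = st_w1 (chi - y).
    by rewrite [RHS]/st_w1 !linearB /= -[usubmx (dsubmx (dsubmx y))]/(st_w1 y) yw1 subr0.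
  apply: le_trans (norm_usubmx _) _; apply: le_trans (norm_dsubmx _) _; exact: norm_dsubmx.
have h4 : `|st_w2 chi| <= d.
  apply: le_d => y [_ [e [_ _ _ yw2]]].
  have -> : st_w2 chi = st_w2 (chi - y).
    rewrite [RHS]/st_w2 !linearB /=.
    by rewrite -[usubmx (dsubmx (dsubmx (dsubmx y)))]/(st_w2 y) yw2 subr0.
  apply: le_trans (norm_usubmx _) _; apply: le_trans (norm_dsubmx _) _.
  apply: le_trans (norm_dsubmx _) _; exact: norm_dsubmx.
rewrite /state_size; lra.
Qed.

Lemma dist_le_state_size (R : realType) (n : nat) (T2 : R) (chi : 'cV[R]_(state_dim n)) :
  0 <= st_tau chi <= T2 -> dist_to (@A_eps R n T2) chi <= (state_dim n)%:R * state_size chi.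
Proof.
move=> tauP.
(* Projection onto the attractor: the two free coordinates are kept, the others set to 0. *)
pose y := mk_state (col_mx (usubmx (st_z1 chi)) 0) (0 : 'cV[R]_(n + n)) 0 0 (st_tau chi).
have Ay : @A_eps R n T2 y.
  split; first by rewrite /X_eps /= /st_tau /y /mk_state !col_mxKd mxE eqxx mulr1n.
  exists (usubmx (st_z1 chi) 0 0); rewrite /y /mk_state /st_z1 /st_z2 /st_w1 /st_w2.
  rewrite !(col_mxKd, col_mxKu); split => //; congr col_mx.
  by apply/matrixP => i j; rewrite !ord1 [RHS]mxE eqxx mulr1n.
apply: (@le_trans _ _ (enorm (chi - y))).
  by apply: ge_inf; [exists 0 => _ [z _ <-]; exact: sqrtr_ge0 | exists y].
apply: le_trans (enorm_le_norm _) _; rewrite ler_wpM2l //.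
have -> : chi - y = mk_state (col_mx 0 (dsubmx (st_z1 chi))) (st_z2 chi) (st_w1 chi) (st_w2 chi) 0.
  rewrite -[chi in LHS]vsubmxK -[dsubmx chi in LHS]vsubmxK.
  rewrite -[dsubmx (dsubmx chi) in LHS]vsubmxK -[dsubmx (dsubmx (dsubmx chi)) in LHS]vsubmxK.
  rewrite -[usubmx chi in LHS]vsubmxK /y /mk_state !opp_col_mx !add_col_mx.
  congr col_mx; first by rewrite subrr subr0.
  congr col_mx; first by rewrite subr0.
  congr col_mx; first by rewrite subr0.
  congr col_mx; first by rewrite subr0.
  rewrite [X in X - _](_ : _ = (st_tau chi)%:M) ?subrr ?raddf0 //.
  by apply/matrixP => i j; rewrite !ord1 [RHS]mxE eqxx mulr1n.
rewrite /mk_state /state_size -!addrA raddf0.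
apply: le_trans (norm_col_mx _ _) _; apply: lerD.
  by apply: le_trans (norm_col_mx _ _) _; rewrite normr0 add0r.
apply: le_trans (norm_col_mx _ _) _; apply: lerD => //.
apply: le_trans (norm_col_mx _ _) _; apply: lerD => //.
by apply: le_trans (norm_col_mx _ _) _; rewrite normr0 addr0.
Qed.

(** The flow set is the preimage of a closed interval under a coordinate, so taking its closure adds
    no initial states. *)
Lemma initial_tau (R : realType) (n : nat) (T1 T2 mu h gamma : R) (T : 'M[R]_(1 + n))
    (lam : 'rV[R]_n) (sigma_star : R) chi :
  let H := H_msigma T1 T2 mu h gamma T lam sigma_star in
  (closure (flow_set H) `|` jump_set H) chi -> 0 <= st_tau chi <= T2.
Proof.
move=> H /= [|[]//]; rewrite -(_ : X_eps T2 = closure (X_eps T2)) //.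
apply/closure_id.
have -> : @X_eps R n T2 = (fun chi => st_tau chi) @^-1` `[0, T2]%classic.
  by apply/seteqP; split => x /=; rewrite in_itv.
apply: closed_comp; last exact: interval_closed.
have stE : (fun chi : 'cV[R]_(state_dim n) => st_tau chi) =
           (fun chi => chi (rshift _ (rshift _ (rshift _ (rshift _ 0)))) 0).
  by apply/funext => z; rewrite /st_tau !mxE.
by rewrite stE => x _; exact: coord_continuous.
Qed.

Lemma state_size_geometric (R : realType) (n : nat) (T1 T2 mu h gamma : R)
    (T : 'M[R]_(1 + n)) (lam : 'rV[R]_n) (sigma_star beta1 beta2 : R)
    (P1 : 'M[R]_(n + n)) (P2 : 'M[R]_(1 + 1)) (P3 : 'M[R]_(n + n)) :
  0 < T1 -> T1 <= T2 -> sym_posdef P1 -> sym_posdef P2 -> sym_posdef P3 ->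
  0 < beta1 -> loewner_le (P2 *m A_f3 mu + (A_f3 mu)^T *m P2) (- beta1%:M) ->
  0 < beta2 -> loewner_le (P3 *m A_f4 n mu + (A_f4 n mu)^T *m P3) (- beta2%:M) ->
  (forall nu, T1 <= nu <= T2 -> negdef (jump_decrease h gamma lam P1 nu)) ->
  exists B L r : R, [/\ 0 < B, 0 < L, 0 < r < 1 &
    forall E phi m M,
      solution_pair (H_msigma T1 T2 mu h gamma T lam sigma_star) E phi m ->
      (forall t j, E (t, j) -> enorm (m t j) <= M) ->
      forall t j, E (t, j) ->
        [/\ 0 <= st_tau (phi t j) <= T2, t <= (j%:R + 1) * T2 &
            state_size (phi t j) <= B * r ^+ j * state_size (phi 0 0%N) + L * M]].
Proof.
move=> T1_gt0 T12 P1p P2p P3p b1 lo1 b2 lo2 neg.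
have T2_gt0 : 0 < T2 by lra.
have [k1 k10 lyap1] := lyapunov_rate P2p b1 lo1.
have [k2 k20 lyap2] := lyapunov_rate P3p b2 lo2.
have [C1 C10 dec1] := decay_bound T1 P2p k10.
have [C2 C20 dec2] := decay_bound T1 P3p k20.
have [rho /andP[rho0 rho1] contr] := jump_contraction T12 P1p neg.
have [c [D [c0 D0 cD]]] := pnorm_equiv P1p.
have [Cz Cz0 CzP] := norm_predict n h (ltW T2_gt0).
pose q1 := expR (- (k1 / 2 * T1)); pose q2 := expR (- (k2 / 2 * T1)).
have q_lt1 k : 0 < k -> expR (- (k / 2 * T1)) < 1.
  by move=> k0; rewrite expR_lt1 oppr_lt0 mulr_gt0 // divr_gt0.
(* A common ratio for all components: it dominates the decay of [w1] and [w2] and stays strictly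
   above [rho], as the denominator [r - rho] requires. *)
pose r := Num.max ((1 + rho) / 2) (Num.max q1 q2).
have rhor : rho < r by rewrite lt_max; apply/orP; left; lra.
have r1 : r < 1 by rewrite !gt_max !q_lt1 // !andbT; lra.
have r0 : 0 < r by lra.
have q1r : q1 <= r by rewrite !le_max lexx orbT.
have q2r : q2 <= r by rewrite !le_max lexx !orbT.
have powle (q : R) j : 0 <= q -> q <= r -> q ^+ j <= r ^+ j.
  by move=> q0 qr; rewrite lerXn2r // nnegrE // ltW.
pose C := D * T2.
have C0 : 0 < C by rewrite mulr_gt0.
pose K := rho * C / (r - rho) + C; pose L := rho * C / (1 - rho) + C.
have K0 : 0 < K by rewrite ltr_wpDl // divr_ge0 ?mulr_ge0 //; lra.
have L0 : 0 < L by rewrite ltr_wpDl // divr_ge0 ?mulr_ge0 //; lra.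
pose G := expR (`|h| * T2); have G0 : 0 < G by exact: expR_gt0.
(* Cost of going back from the [P1] norm of the predicted state to the max norm of [z2]. *)
pose F := Cz / c; have F0 : 0 < F by rewrite divr_gt0.
have FD0 : 0 < F * D * Cz by exact: mulr_gt0 (mulr_gt0 F0 D0) Cz0.
have FK0 : 0 < F * K * C2 by exact: mulr_gt0 (mulr_gt0 F0 K0) C20.
exists (G + C1 + C2 + F * K * C2 + F * D * Cz), (F * L), r; split.
- by rewrite !addr_gt0.
- by rewrite mulr_gt0.
- by rewrite r0 r1.
move=> E phi m M sol mM s J EsJ.
have [t [t0 sJ mem flowP jumpP]] := solution_intervals sol EsJ.
have tS j : (j <= J)%N -> t j <= t j.+1 by move=> /mem[].
have tau0 : 0 <= st_tau (phi 0 0%N) <= T2 by case: sol => _ _ /initial_tau.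
have dur j u (jJ : (j <= J)%N) (ju : t j <= u <= t j.+1) :=
  during T1_gt0 t0 tS flowP jumpP tau0 jJ ju.
have M0 : 0 <= M by apply: le_trans (mM _ _ EsJ); exact: sqrtr_ge0.
have [sT _ sj1 sj2] := dur J s (leqnn J) sJ.
set w1_0 := `|st_w1 (phi 0 0%N)|; set w2_0 := `|st_w2 (phi 0 0%N)|.
have w2P j u : (j <= J)%N -> t j <= u <= t j.+1 -> `|st_w2 (phi u j)| <= r ^+ j * (C2 * w2_0).
  move=> jJ ju; have [_ _ uj _] := dur j u jJ ju.
  apply: le_trans (dec2 _ _ _ _ uj (w2_decay t0 tS flowP jumpP lyap2 jJ ju)) _.
  rewrite -/w2_0 mulrAC [leRHS]mulrC ler_wpM2l //; last exact: powle (expR_ge0 _) q2r.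
  exact: mulr_ge0 (ltW C20) (normr_ge0 _).
have w1P : `|st_w1 (phi s J)| <= r ^+ J * (C1 * w1_0).
  apply: le_trans (dec1 _ _ _ _ sj1 (w1_decay t0 tS flowP jumpP lyap1 (leqnn J) sJ)) _.
  rewrite -/w1_0 mulrAC [leRHS]mulrC ler_wpM2l //; last exact: powle (expR_ge0 _) q1r.
  exact: mulr_ge0 (ltW C10) (normr_ge0 _).
have etaP := eta1_bound T1_gt0 t0 tS flowP jumpP tau0 (ltW r0) (leqnn J) sJ.
have PD z : pnorm P1 z <= D * `|z| by have /andP[] := cD z.
have xP := predict_bound T1_gt0 T12 t0 tS flowP jumpP tau0 P1p rho0 rhor r1 (ltW D0)
  (lexx (D * T2)) M0 (mulr_ge0 (ltW C20) (normr_ge0 _)) PD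
  contr w2P _ (leqnn J) sJ.
split => //.
have {xP} : pnorm P1 (predict h (st_tau (phi s J)) (st_z2 (phi s J))) <=
    r ^+ J * (D * (Cz * `|st_z2 (phi 0 0%N)|) + K * (C2 * w2_0)) + L * M.
  apply: le_trans (xP _) _.
    move=> j u jJ ju; apply: le_trans (norm_dsubmx _) _; apply: le_trans (norm_le_enorm _) _.
    by apply: mM; apply: (mem j jJ).2.
  rewrite -/C -/K -/L lerD2r ler_wpM2l ?exprn_ge0 ?(ltW r0) // lerD2r.
  apply: le_trans (PD _) _; rewrite ler_pM2l //.
  exact: (CzP _ _ tau0).2.
set x := predict _ _ _ => xP.
have zP : `|st_z2 (phi s J)| <= F * pnorm P1 x.
  have [h1 _] := CzP _ (st_z2 (phi s J)) sT; apply: le_trans h1 _.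
  rewrite /F -mulrA ler_pM2l // mulrC ler_pdivlMr // mulrC.
  by have /andP[] := cD x.
have {xP} zP2 : `|st_z2 (phi s J)| <=
    F * (r ^+ J * (D * (Cz * `|st_z2 (phi 0 0%N)|) + K * (C2 * w2_0)) + L * M).
  by apply: le_trans zP _; rewrite ler_pM2l.
have w2J := w2P J s (leqnn J) sJ.
rewrite /state_size -/w1_0 -/w2_0; rewrite -/G in etaP.
move: (`|dsubmx (st_z1 (phi 0 0%N))|) (normr_ge0 (dsubmx (st_z1 (phi 0 0%N)))) etaP.
move=> e0 e0_ge0 etaP.
move: (`|st_z2 (phi 0 0%N)|) (normr_ge0 (st_z2 (phi 0 0%N))) zP2 => z0 z0_ge0 zP2.
have w10 : 0 <= w1_0 by exact: normr_ge0.
have w20 : 0 <= w2_0 by exact: normr_ge0.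
have rJ : 0 <= r ^+ J by rewrite exprn_ge0 // ltW.
(* Each initial component appears with its own constant; adding the nonnegative cross terms makes
   their sum the common factor of [state_size]. *)
apply: (@le_trans _ _ (r ^+ J * (G * e0 + C1 * w1_0 + C2 * w2_0 + F * K * C2 * w2_0
                                 + F * D * Cz * z0) + F * L * M)); first by lra.
rewrite lerD2r -[leRHS]mulrA [leRHS]mulrCA ler_wpM2l //.
have := mulr_ge0 (ltW G0); have := mulr_ge0 (ltW C10); have := mulr_ge0 (ltW C20).
have := mulr_ge0 (ltW FD0); have := mulr_ge0 (ltW FK0) => pFK pFD pC2 pC1 pG.
have := pFK _ e0_ge0; have := pFK _ z0_ge0; have := pFK _ w10.
have := pFD _ e0_ge0; have := pFD _ w20; have := pFD _ w10.
have := pC2 _ e0_ge0; have := pC2 _ z0_ge0; have := pC2 _ w10.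
have := pC1 _ e0_ge0; have := pC1 _ z0_ge0; have := pC1 _ w20.
have := pG _ w10; have := pG _ z0_ge0; have := pG _ w20.
lra.
Qed.
Theorem theorem6p4 (R : realType) (n : nat) (e : rel 'I_(1 + n))
  (T : 'M[R]_(1 + n)) (lam : 'rV[R]_n) (sigma_star : R)
  (T1 T2 mu h gamma eps beta1 beta2 kappa2 : R)
  (P1 : 'M[R]_(n + n)) (P2 : 'M[R]_(1 + 1)) (P3 : 'M[R]_(n + n))
  (e_connected : strongly_connected e)
  (T_basis : laplacian_basis e T lam)
  (T1_gt0 : 0 < T1) (T1_le_T2 : T1 <= T2)
  (mu_gt0 : 0 < mu) (gamma_gt0 : 0 < gamma) (eps_gt0 : 0 < eps)
  (P1_posdef : sym_posdef P1) (P2_posdef : sym_posdef P2) (P3_posdef : sym_posdef P3)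
  (beta1_gt0 : 0 < beta1)
  (beta1P : loewner_le (P2 *m A_f3 mu + (A_f3 mu)^T *m P2) (- beta1%:M))
  (beta2_gt0 : 0 < beta2)
  (beta2P : loewner_le (P3 *m A_f4 n mu + (A_f4 n mu)^T *m P3) (- beta2%:M))
  (kappa2_gt0 : 0 < kappa2)
  (kappa2_lt : kappa2 < kappa2_sup h gamma T1 T2 lam P1)
  (jump_decreaseP : forall nu, T1 <= nu <= T2 ->
     negdef (jump_decrease h gamma lam P1 nu))
  (small_gain :
     `| expR (kappa1_bar h T2 eps beta2 P1 / alpha2 h T2 P1 P2 P3 * T2)
        * (1 - kappa2_bar kappa2 / alpha2 h T2 P1 P2 P3) | < 1) :
  input_to_state_stable (H_msigma T1 T2 mu h gamma T lam sigma_star)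
    (@A_eps R n T2).
Proof.
have [B [L [r [B0 L0 /andP[r0 r1] bound]]]] := state_size_geometric T sigma_star T1_gt0 T1_le_T2
  P1_posdef P2_posdef P3_posdef beta1_gt0 beta1P beta2_gt0 beta2P jump_decreaseP.
have T2_gt0 : 0 < T2 by lra.
have N0 : 0 < (state_dim n)%:R :> R by rewrite ltr0n.
(* The factors [state_dim n] and 4 come from comparing [state_size] with the distance, at the
   current and at the initial state respectively. *)
apply: (@iss_of_geometric_bound _ _ _ _ _ ((state_dim n)%:R * (B * 4)) ((state_dim n)%:R * L) r T2);
  rewrite ?mulr_gt0 // => E phi m M sol mM t j Etj.
have [tauT tj size_le] := bound E phi m M sol mM t j Etj; split => //.
apply: le_trans (dist_le_state_size tauT) _.
rewrite -!mulrA -mulrDr ler_pM2l //; apply: le_trans size_le _.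
rewrite lerD2r -mulrA ler_pM2l // [4 * _]mulrCA ler_wpM2l ?exprn_ge0 ?(ltW r0) //.
by apply: state_size_le_dist; exact: ltW.
Qed.
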